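(* For every identity $u\approx v$ there is a finite set $$E\subseteq\mathcal F_{25}\cup\{\gamma_n,\gamma_n^D:n\ge1\}$$ such that $\mathcal V[u\approx v]=\mathcal V[E]$.
   Context: Language: two binary operations $+,\cdot$, no constants. $u\preceq v$ abbreviates $u+v\approx v$. The semiring $R_{12}$: its universe is $\{0,c,p,q,a,b\}$ (letters used as elements only in this paragraph); multiplication is commutative with only nonzero products $pb=bp=ab=ba=aq=qa=c$; addition is the join of the partial order generated by $a<p<0$, $b<q<0$, $c<0$, $a<c$, $b<q<c$. $\mathcal V=\mathsf V(R_{12})$ is the variety generated by $R_{12}$, and $\mathcal V[E]$ is the subvariety of $\mathcal V$ defined by adjoining the identities in $E$. Abbreviations: $C(t,u)=t+tu$, $D(t,u)=t+u+tu$, $L(a,b,c,d)=ab+bc+cd$ (all letters variables). $\mathcal F_{25}$ consists of the 25 identities: $\rho: x\preceq xy$; $\eta: z\preceq x+xy+yz$; $\omega: y\preceq x+xy$; $\zeta: z\preceq C(x,y)+zt$; $\lambda: z\preceq D(x,y)+xz$; $\eta_D: z\preceq x+xy+yz+D(t,u)$; $\omega_D: y\preceq C(x,y)+D(t,u)$; $\zeta_D: z\preceq D(x,y)+zt$; $\mu: ad\preceq b+L(a,b,c,d)$; $\nu: ad\preceq C(t,u)+L(a,b,c,d)$; $\mu_2: ad\preceq b+c+L(a,b,c,d)$; $\mu_D: ad\preceq b+L(a,b,c,d)+D(t,u)$; $\nu_D: ad\preceq L(a,b,c,d)+D(t,u)$; $\delta: ad\preceq L(a,b,c,d)$; $\xi: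 x^2\approx D(x,y)$; $\beta: xz\preceq C(x,y)+C(t,z)$; $s: x^2\approx C(x,y)$; $\chi: x^2\approx xy$; $\tau: x\approx y$; $\alpha: ad\preceq a+L(a,b,c,d)$; $\alpha_D: ad\preceq a+L(a,b,c,d)+D(t,u)$; $\varepsilon: ad\preceq a+b+c+L(a,b,c,d)$; $\kappa: ad\preceq a+b+L(a,b,c,d)$; $\iota_2: x_0x_5\preceq x_1+\sum_{j=0}^4x_jx_{j+1}$; $\iota_2^D: x_0x_5\preceq x_1+\sum_{j=0}^4x_jx_{j+1}+D(t,u)$. For $n\ge1$: $$\gamma_n:\ x_0y\preceq x_0+x_{2n}+\sum_{j=0}^{2n-1}x_jx_{j+1}+x_{2n}y,\qquad \gamma_n^D:\ x_0y\preceq x_0+x_{2n}+\sum_{j=0}^{2n-1}x_jx_{j+1}+x_{2n}y+D(t,u).$$ *)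

(* Defs.v *)
From Stdlib Require Import List Relations.

Declare Scope alg_scope.
Declare Scope term_scope.
Delimit Scope term_scope with term.

(** * Algebras with two binary operations, terms, identities *)

Record algebra : Type := Algebra {
  carrier :> Type;
  add : carrier -> carrier -> carrier;
  mul : carrier -> carrier -> carrier;
  carrier_inhabited : inhabited carrier
}.
Arguments add {a} _ _.
Arguments mul {a} _ _.

Inductive term : Type :=
| Var (i : nat)
| Add (t1 t2 : term)
| Mul (t1 t2 : term).
Bind Scope term_scope with term.

Notation "t1 + t2" := (Add t1 t2) : term_scope.
Notation "t1 * t2" := (Mul t1 t2) : term_scope.

Fixpoint eval (A : algebra) (v : nat -> A) (w : term) : A :=
  match w with
  | Var i => v i
  | Add w1 w2 => add (eval A v w1) (eval A v w2)
  | Mul w1 w2 => mul (eval A v w1) (eval A v w2)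
  end.

Record identity : Type := Identity { lhs : term; rhs : term }.

Notation "w1 ≈ w2" := (Identity w1%term w2%term) (at level 70) : alg_scope.
Notation "w1 ⪯ w2" := (Identity (Add w1%term w2%term) w2%term)
  (at level 70) : alg_scope.
Open Scope alg_scope.

Definition satisfies (A : algebra) (e : identity) : Prop :=
  forall v : nat -> A, eval A v (lhs e) = eval A v (rhs e).

(** * Varieties *)

Definition is_hom (A B : algebra) (f : A -> B) : Prop :=
  (forall x y, f (add x y) = add (f x) (f y)) /\
  (forall x y, f (mul x y) = mul (f x) (f y)).

(* Closure under homomorphic images, under (isomorphic copies of) subalgebras,
   and under (isomorphic copies of) direct products: [P], with the projections
   [pr], is a direct product of the family [F] when every choice of coordinates
   is realized by exactly one element of [P]. *)
Definition is_variety (K : algebra -> Prop) : Prop :=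
  (forall (A B : algebra) (f : A -> B),
      is_hom A B f -> (forall b, exists a, f a = b) -> K A -> K B) /\
  (forall (A B : algebra) (f : B -> A),
      is_hom B A f -> (forall b1 b2, f b1 = f b2 -> b1 = b2) -> K A -> K B) /\
  (forall (I : Type) (F : I -> algebra) (P : algebra)
          (pr : forall i, P -> F i),
      (forall i, is_hom P (F i) (pr i)) ->
      (forall x : forall i, F i, exists! y : P, forall i, pr i y = x i) ->
      (forall i, K (F i)) -> K P).

(* The least variety containing [A]. *)
Definition variety_gen (A : algebra) : algebra -> Prop :=
  fun B => forall K, is_variety K -> K A -> K B.

Definition subvariety (K : algebra -> Prop) (E : list identity) :
    algebra -> Prop :=
  fun B => K B /\ forall e, In e E -> satisfies B e.

(** * The semiring R12 *)

Inductive r12 : Set := r0 | rc | rp | rq | ra | rb.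

Definition r12_mul (x y : r12) : r12 :=
  match x, y with
  | rp, rb | rb, rp | ra, rb | rb, ra | ra, rq | rq, ra => rc
  | _, _ => r0
  end.

Inductive r12_lt_gen : r12 -> r12 -> Prop :=
| lt_ap : r12_lt_gen ra rp
| lt_p0 : r12_lt_gen rp r0
| lt_bq : r12_lt_gen rb rq
| lt_q0 : r12_lt_gen rq r0
| lt_c0 : r12_lt_gen rc r0
| lt_ac : r12_lt_gen ra rc
| lt_qc : r12_lt_gen rq rc.

Definition r12_le : r12 -> r12 -> Prop := clos_refl_trans r12 r12_lt_gen.

(* The table of joins for [r12_le]; see [r12_add_join]. *)
Definition r12_add (x y : r12) : r12 :=
  match x, y with
  | ra, ra => ra
  | rb, rb => rb
  | rp, rp | ra, rp | rp, ra => rp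
  | rq, rq | rb, rq | rq, rb => rq
  | rc, rc | ra, rc | rc, ra | rb, rc | rc, rb | rq, rc | rc, rq
  | ra, rb | rb, ra | ra, rq | rq, ra => rc
  | _, _ => r0
  end.

Lemma r12_leE (x y : r12) : r12_le x y <-> r12_add x y = y.
Proof.
split.
- intros H; induction H as [x y []|x|x y z _ IH1 _ IH2]; try reflexivity.
  + now destruct x.
  + revert IH1 IH2; destruct x, y, z; simpl; congruence.
- unfold r12_le; destruct x, y; simpl; intros H; try discriminate H;
    try (apply rt_refl);
    try (apply rt_step; constructor);
    first [ apply rt_trans with rp; apply rt_step; constructor
          | apply rt_trans with rq; apply rt_step; constructor ].
Qed.

Lemma r12_add_join (x y : r12) :
  r12_le x (r12_add x y) /\ r12_le y (r12_add x y) /\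
  forall z, r12_le x z -> r12_le y z -> r12_le (r12_add x y) z.
Proof.
repeat split; try intros z; rewrite !r12_leE.
- now destruct x, y.
- now destruct x, y.
- destruct x, y, z; simpl; congruence.
Qed.

Definition R12 : algebra := Algebra r12 r12_add r12_mul (inhabits r0).

(** * The identities *)

Definition Ct (t u : term) : term := t + t * u.
Definition Dt (t u : term) : term := t + u + t * u.
Definition Lt (a b c d : term) : term := a * b + b * c + c * d.

(* [tsum f m] is the sum of [f j] over [0 <= j <= m]. *)
Fixpoint tsum (f : nat -> term) (m : nat) : term :=
  match m with
  | 0 => f 0
  | S k => tsum f k + f (S k)
  end.

Section Identities.

Local Notation x := (Var 0).
Local Notation y := (Var 1).
Local Notation z := (Var 2).
Local Notation t := (Var 3).
Local Notation u := (Var 4).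
Local Notation a := (Var 5).
Local Notation b := (Var 6).
Local Notation c := (Var 7).
Local Notation d := (Var 8).
(* The indexed variables [x_j], distinct from all the letters above. *)
Local Notation x_ j := (Var (9 + j)).

Definition id_rho := x ⪯ x * y.
Definition id_eta := z ⪯ x + x * y + y * z.
Definition id_omega := y ⪯ x + x * y.
Definition id_zeta := z ⪯ Ct x y + z * t.
Definition id_lambda := z ⪯ Dt x y + x * z.
Definition id_eta_D := z ⪯ x + x * y + y * z + Dt t u.
Definition id_omega_D := y ⪯ Ct x y + Dt t u.
Definition id_zeta_D := z ⪯ Dt x y + z * t.
Definition id_mu := a * d ⪯ b + Lt a b c d.
Definition id_nu := a * d ⪯ Ct t u + Lt a b c d.
Definition id_mu2 := a * d ⪯ b + c + Lt a b c d.
Definition id_mu_D := a * d ⪯ b + Lt a b c d + Dt t u.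
Definition id_nu_D := a * d ⪯ Lt a b c d + Dt t u.
Definition id_delta := a * d ⪯ Lt a b c d.
Definition id_xi := x * x ≈ Dt x y.
Definition id_beta := x * z ⪯ Ct x y + Ct t z.
Definition id_s := x * x ≈ Ct x y.
Definition id_chi := x * x ≈ x * y.
Definition id_tau := x ≈ y.
Definition id_alpha := a * d ⪯ a + Lt a b c d.
Definition id_alpha_D := a * d ⪯ a + Lt a b c d + Dt t u.
Definition id_epsilon := a * d ⪯ a + b + c + Lt a b c d.
Definition id_kappa := a * d ⪯ a + b + Lt a b c d.
Definition id_iota2 :=
  x_ 0 * x_ 5 ⪯ x_ 1 + tsum (fun j => x_ j * x_ (j + 1)) 4.
Definition id_iota2_D :=
  x_ 0 * x_ 5 ⪯ x_ 1 + tsum (fun j => x_ j * x_ (j + 1)) 4 + Dt t u.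

Definition F25 : list identity :=
  id_rho :: id_eta :: id_omega :: id_zeta :: id_lambda ::
  id_eta_D :: id_omega_D :: id_zeta_D ::
  id_mu :: id_nu :: id_mu2 :: id_mu_D :: id_nu_D :: id_delta ::
  id_xi :: id_beta :: id_s :: id_chi :: id_tau ::
  id_alpha :: id_alpha_D :: id_epsilon :: id_kappa ::
  id_iota2 :: id_iota2_D :: nil.

(* Meant for [1 <= n]. *)
Definition id_gamma (n : nat) :=
  x_ 0 * y ⪯ x_ 0 + x_ (2 * n)
             + tsum (fun j => x_ j * x_ (j + 1)) (2 * n - 1) + x_ (2 * n) * y.
Definition id_gamma_D (n : nat) :=
  x_ 0 * y ⪯ x_ 0 + x_ (2 * n)
             + tsum (fun j => x_ j * x_ (j + 1)) (2 * n - 1) + x_ (2 * n) * y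
             + Dt t u.

End Identities.

(* Main.v *)
(* In V every product with three factors and every square is the greatest
   element, so a term is a set of letters and a graph of products, and u ≈ v
   splits into inequalities m ⪯ s with m a monomial.  When the graph of s is not
   bipartite the inequality already holds in V.  Otherwise folding the graph of s
   onto a short path, or onto the path of some γ_n, shows which listed identities
   follow from m ⪯ s; conversely these identities, applied step by step along
   walks in the graph of s, produce m below s.
   For m = xy with x, y joined by an odd walk, the relevant identities depend on
   which sides of the component carry letters of s, and on whether x and y are
   near such letters.  The γ_n arise when the only way from x to a letter next to
   y is a chain of letters: n is the least number such that jumps of length 2n
   suffice, and the failure of jumps of length 2(n-1) is the cut that allows the
   fold onto the path of γ_n. *)

From Stdlib Require Import List Lia Bool Arith Classical ClassicalEpsilon.
Require Import Defs.
Import ListNotations.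

Local Notation dec := excluded_middle_informative.

(** * Models of the equational theory of R12 *)

(** Throughout, [m ⪯ s] is an implication about an arbitrary element [r] of a model: if every
    monomial of s lies below [r], so does m. To derive a listed identity from it, s is evaluated in
    the model so that its whole graph lands below a prescribed [r]. The obstacle is the part of s
    away from m, which has to land below [r] as well. One product below [r] suffices for that, with
    none, one or both of its factors below [r], according to how the letters sit in s. This is the
    origin of the versions without side term, with C(t,u) and with D(t,u). Conversely, such a
    product lies below [r] whenever s does, so the side term is always available. Identities such as
    η, α or γ_n have no version with C(t,u) because a letter next to an edge already forms a copy of
    C. If x and y lie in different components, colours can usually be flipped in one of them, and x,
    y fold to one element. Only in the kind with C(t,u), with letters in both components, is this
    blocked; that is where β enters. *)

Definition model (B : algebra) : Prop :=
  forall e, satisfies R12 e -> satisfies B e.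

Lemma eval_ext (A : algebra) (v w : nat -> A) (s : term) :
  (forall i, v i = w i) -> eval A v s = eval A w s.
Proof. intros H; induction s; simpl; congruence. Qed.

Lemma eval_hom (A B : algebra) (f : A -> B) (v : nat -> A) (s : term) :
  is_hom A B f -> f (eval A v s) = eval B (fun i => f (v i)) s.
Proof.
intros [Hadd Hmul]; induction s; simpl; rewrite ?Hadd, ?Hmul; congruence.
Qed.

(** Hence every member of the generated variety is a model; both subvarieties to be compared share
    the membership condition, so all else can be done over models. *)
Lemma model_is_variety : is_variety model.
Proof.
split; [|split].
- intros A B f Hf surj HA e He v.
  assert (Hw : forall i, {a | f a = v i})
    by (intros i; apply constructive_indefinite_description, surj).
  pose (w := fun i => proj1_sig (Hw i)).
  assert (E : forall s, eval B v s = f (eval A w s)).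
  { intros s; rewrite (eval_hom A B f w s Hf); apply eval_ext.
    intros i; unfold w; now destruct (Hw i). }
  rewrite !E; f_equal; now apply HA.
- intros A B f Hf inj HA e He v.
  apply inj; rewrite !(eval_hom B A f _ _ Hf); now apply HA.
- intros I F P pr Hpr uniq HF e He v.
  destruct (uniq (fun i => pr i (eval P v (lhs e)))) as [y [_ Hy]].
  rewrite <- (Hy (eval P v (lhs e))) by reflexivity.
  apply Hy; intros i.
  rewrite !(eval_hom P (F i) (pr i) _ _ (Hpr i)); symmetry; now apply HF.
Qed.

Lemma model_variety_gen (B : algebra) : variety_gen R12 B -> model B.
Proof. intros H; apply (H model model_is_variety); now intros e. Qed.

Lemma model_R12 : model R12.
Proof. now intros e. Qed.

Definition le {B : algebra} (x y : B) : Prop := add x y = y.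
Local Notation "x ≼ y" := (le x y) (at level 70).
Local Notation "x ⊙ y" := (mul x y) (at level 40, left associativity).

Definition top {B : algebra} (r : B) : Prop := forall x, x ≼ r.

Ltac r12_check := intros v; cbn -[r12_add r12_mul] in *;
  repeat match goal with
  | |- context [v ?i] => destruct (v i)
  end; reflexivity.

Section Model.

Context {B : algebra} (HB : model B).

Let tri (x y z : B) (i : nat) : B :=
  match i with 0 => x | 1 => y | _ => z end.

Ltac from_R12 e x y z :=
  refine (HB e _ (tri x y z)); r12_check.

Lemma addA (x y z : B) : add x (add y z) = add (add x y) z.
Proof.
from_R12 (Var 0 + (Var 1 + Var 2) ≈ Var 0 + Var 1 + Var 2) x y z.
Qed.

Lemma addC (x y : B) : add x y = add y x.
Proof. from_R12 (Var 0 + Var 1 ≈ Var 1 + Var 0) x y y. Qed.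

Lemma addI (x : B) : add x x = x.
Proof. from_R12 (Var 0 + Var 0 ≈ Var 0) x x x. Qed.

Lemma mulC (x y : B) : x ⊙ y = y ⊙ x.
Proof. from_R12 (Var 0 * Var 1 ≈ Var 1 * Var 0) x y y. Qed.

Lemma mulDl (x y z : B) : add x y ⊙ z = add (x ⊙ z) (y ⊙ z).
Proof.
from_R12 ((Var 0 + Var 1) * Var 2 ≈ Var 0 * Var 2 + Var 1 * Var 2) x y z.
Qed.

Lemma top_sqr (x : B) : top (x ⊙ x).
Proof. intros y; from_R12 (Var 1 ⪯ Var 0 * Var 0) x y y. Qed.

Lemma sqr_le_mul3 (x y z : B) : x ⊙ x ≼ x ⊙ y ⊙ z.
Proof. from_R12 (Var 0 * Var 0 ⪯ Var 0 * Var 1 * Var 2) x y z. Qed.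

Lemma le_refl (x : B) : x ≼ x.
Proof. apply addI. Qed.

Lemma le_trans (x y z : B) : x ≼ y -> y ≼ z -> x ≼ z.
Proof. unfold le; intros H1 H2; rewrite <- H2, addA, H1; reflexivity. Qed.

Lemma le_antisym (x y : B) : x ≼ y -> y ≼ x -> x = y.
Proof. unfold le; intros H1 H2; rewrite <- H1, addC; symmetry; exact H2. Qed.

Lemma add_le (x y z : B) : add x y ≼ z <-> x ≼ z /\ y ≼ z.
Proof.
unfold le; split.
- intros H; split; rewrite <- H.
  + now rewrite !addA, addI.
  + now rewrite (addC x y), !addA, addI.
- intros [H1 H2]; now rewrite <- addA, H2, H1.
Qed.

Lemma le_addl (x y z : B) : x ≼ y -> x ≼ add y z.
Proof.
intros H; apply le_trans with (1 := H), (proj1 (add_le y z _)), le_refl.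
Qed.

Lemma le_addr (x y z : B) : x ≼ z -> x ≼ add y z.
Proof.
intros H; apply le_trans with (1 := H), (proj1 (add_le y z _)), le_refl.
Qed.

Lemma le_top (x y : B) : top x -> x ≼ y -> top y.
Proof. intros H1 H2 z; apply le_trans with (2 := H2), H1. Qed.

Lemma top_mul3 (x y z : B) : top (x ⊙ y ⊙ z).
Proof. apply le_top with (1 := top_sqr x), sqr_le_mul3. Qed.

Lemma sqr_le (x r : B) : x ⊙ x ≼ r -> top r.
Proof. apply le_top, top_sqr. Qed.

Lemma mul3_le (x y z r : B) : x ⊙ y ⊙ z ≼ r -> top r.
Proof. apply le_top, top_mul3. Qed.

Lemma le_mulC (x y r : B) : x ⊙ y ≼ r -> y ⊙ x ≼ r.
Proof. now rewrite mulC. Qed.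

End Model.

(** * Monomials *)

(* [M0] stands for the products with at least three factors, which all denote
   the greatest element. *)
Inductive mon : Type := M0 | M1 (x : nat) | M2 (x y : nat).

Definition mmul (m n : mon) : mon :=
  match m, n with M1 x, M1 y => M2 x y | _, _ => M0 end.

Fixpoint mons (s : term) : list mon :=
  match s with
  | Var i => [M1 i]
  | Add s1 s2 => mons s1 ++ mons s2
  | Mul s1 s2 => map (fun p => mmul (fst p) (snd p))
                     (list_prod (mons s1) (mons s2))
  end.

Definition mle {B : algebra} (v : nat -> B) (m : mon) (r : B) : Prop :=
  match m with
  | M0 => top r
  | M1 x => v x ≼ r
  | M2 x y => v x ⊙ v y ≼ r
  end.

Lemma mons_inhabited (s : term) : exists m, In m (mons s).
Proof.
induction s as [i|s1 [m1 H1] s2 _|s1 [m1 H1] s2 [m2 H2]]; simpl.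
- now exists (M1 i); left.
- exists m1; rewrite in_app_iff; now left.
- exists (mmul m1 m2); rewrite in_map_iff; exists (m1, m2).
  now rewrite in_prod_iff.
Qed.

Lemma in_mons_mul (s1 s2 : term) (m : mon) :
  In m (mons (s1 * s2)%term) <->
  exists m1 m2, In m1 (mons s1) /\ In m2 (mons s2) /\ m = mmul m1 m2.
Proof.
simpl; rewrite in_map_iff; split.
- intros [[m1 m2] [<- H]]; rewrite in_prod_iff in H; exists m1, m2; tauto.
- intros (m1 & m2 & H1 & H2 & ->); exists (m1, m2).
  now rewrite in_prod_iff.
Qed.

(** The product case of [eval_le], with one factor frozen to the element [c]: times [c], a monomial
    of at least two factors becomes a product of three, hence greatest, so only the letters give
    real conditions. *)
Lemma eval_mul_le (B : algebra) (HB : model B) (v : nat -> B) (c r : B)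
    (s : term) :
  eval B v s ⊙ c ≼ r <->
  forall m, In m (mons s) ->
    match m with M1 x => v x ⊙ c ≼ r | _ => top r end.
Proof.
induction s as [i|s1 IH1 s2 IH2|s1 _ s2 _].
- simpl; split; [now intros H m [<-|[]]|].
  intros H; now apply (H (M1 i)); left.
- simpl; rewrite (mulDl HB), (add_le HB), IH1, IH2.
  setoid_rewrite in_app_iff; firstorder.
- split; intros H.
  + intros m Hm; apply in_mons_mul in Hm as (m1 & m2 & _ & _ & ->).
    apply (mul3_le HB) in H; destruct m1, m2; exact H.
  + assert (T : top r); [|apply T].
    destruct (mons_inhabited s1) as [m1 H1], (mons_inhabited s2) as [m2 H2].
    specialize (H (mmul m1 m2)); rewrite in_mons_mul in H.
    destruct m1, m2; apply H; eauto.
Qed.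

Lemma eval_le (B : algebra) (HB : model B) (v : nat -> B) (r : B) (s : term) :
  eval B v s ≼ r <-> forall m, In m (mons s) -> mle v m r.
Proof.
induction s as [i|s1 IH1 s2 IH2|s1 _ s2 _].
- simpl; split; [now intros H m [<-|[]]|].
  intros H; now apply (H (M1 i)); left.
- simpl; rewrite (add_le HB), IH1, IH2.
  setoid_rewrite in_app_iff; firstorder.
- change (eval B v (s1 * s2)%term) with (eval B v s1 ⊙ eval B v s2).
  rewrite (eval_mul_le B HB); split; intros H.
  + intros m Hm; apply in_mons_mul in Hm as (m1 & m2 & H1 & H2 & ->).
    specialize (H m1 H1); destruct m1 as [|x|x y]; simpl; try exact H.
    rewrite (mulC HB), (eval_mul_le B HB) in H.
    specialize (H m2 H2); destruct m2; simpl; try exact H.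
    now rewrite (mulC HB).
  + intros m1 H1.
    assert (H' : forall m2, In m2 (mons s2) -> mle v (mmul m1 m2) r).
    { intros m2 H2; apply H, in_mons_mul; eauto. }
    destruct (mons_inhabited s2) as [m2 H2].
    destruct m1 as [|x|x y]; try exact (H' m2 H2).
    rewrite (mulC HB), (eval_mul_le B HB).
    intros m3 H3; specialize (H' m3 H3); destruct m3; simpl in H'; try exact H'.
    now rewrite (mulC HB).
Qed.

(** Taking [r] to be the value of [s2] recovers the inequality; allowing every upper bound [r] frees
    the later folds from hitting that value exactly. *)
Lemma satisfies_le (B : algebra) (HB : model B) (s1 s2 : term) :
  satisfies B (s1 ⪯ s2) <->
  forall m, In m (mons s1) ->
    forall (v : nat -> B) (r : B),
      (forall n, In n (mons s2) -> mle v n r) -> mle v m r.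
Proof.
change (satisfies B (s1 ⪯ s2)) with (forall v, eval B v s1 ≼ eval B v s2).
split.
- intros H m Hm v r Hr; apply (eval_le B HB) in Hr.
  apply (eval_le B HB v r s1); auto.
  now apply (le_trans HB) with (1 := H v).
- intros H v; apply (eval_le B HB); intros m Hm; apply H; auto.
  apply (eval_le B HB), (le_refl HB).
Qed.

Lemma satisfies_eq (B : algebra) (HB : model B) (s1 s2 : term) :
  satisfies B (s1 ≈ s2) <-> satisfies B (s1 ⪯ s2) /\ satisfies B (s2 ⪯ s1).
Proof.
split.
- intros H; split; intros v; specialize (H v); simpl in *; rewrite H;
    apply (addI HB).
- intros [H1 H2] v; apply (le_antisym HB); [apply H1|apply H2].
Qed.

(** * Terms evaluated in R12 *)

Section TermGraph.

Variable s : term.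

Definition letter (x : nat) : Prop := In (M1 x) (mons s).
Definition edge (x y : nat) : Prop :=
  In (M2 x y) (mons s) \/ In (M2 y x) (mons s).

Lemma edge_sym (x y : nat) : edge x y -> edge y x.
Proof. unfold edge; tauto. Qed.

(** The nonzero products join one of a, p to one of b, q, so a valuation that keeps s away from 0
    colours the graph of s with two colours. *)
Definition r12_col (x : r12) : bool :=
  match x with ra | rp => true | _ => false end.

Lemma r12_le_r0 (x : R12) : x ≼ (r0 : R12).
Proof. now destruct x. Qed.

(** Every product is c or 0, and only c and 0 lie above c. *)
Lemma edge_r12 (v : nat -> R12) (x y : nat) :
  eval R12 v s <> r0 -> edge x y ->
  v x ⊙ v y = rc /\ eval R12 v s = rc.
Proof.
intros H0 Hxy.
assert (H : v x ⊙ v y ≼ eval R12 v s).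
{ assert (H := proj1 (eval_le R12 model_R12 v _ s) (le_refl model_R12 _)).
  destruct Hxy as [Hxy|Hxy]; specialize (H _ Hxy); simpl mle in H; auto.
  now apply (le_mulC model_R12). }
revert H H0; destruct (eval R12 v s), (v x), (v y);
  unfold le; simpl; intros; split; congruence.
Qed.

Lemma edge_r12_col (v : nat -> R12) (x y : nat) :
  eval R12 v s <> r0 -> edge x y ->
  r12_col (v y) = negb (r12_col (v x)).
Proof.
intros H0 Hxy; destruct (edge_r12 v x y H0 Hxy) as [H _].
revert H; destruct (v x), (v y); simpl; congruence.
Qed.

Lemma satisfies_R12_le (s1 : term) :
  (forall v, eval R12 v s <> r0 -> eval R12 v s1 ≼ eval R12 v s) ->
  satisfies R12 (s1 ⪯ s).
Proof.
intros H v; destruct (classic (eval R12 v s = r0)) as [H0|H0].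
- change (eval R12 v s1 ≼ eval R12 v s); rewrite H0; apply r12_le_r0.
- now apply H.
Qed.

End TermGraph.

(** * The listed identities as implications *)

(* The three families of the list: without side term, with [C(t,u)], and with
   [D(t,u)]. *)
Inductive kind : Type := KN | KC | KD.

(* Below [r] lies a copy of [xy], of [C(x,y)] or of [D(x,y)]. *)
Definition pat {B : algebra} (k : kind) (r : B) : Prop :=
  exists x y, x ⊙ y ≼ r /\
    match k with KN => True | KC => x ≼ r | KD => x ≼ r /\ y ≼ r end.

(** Squares are greatest, so χ, s and ξ, which equate a square with a pattern, say exactly that the
    pattern is greatest. *)
Definition zero_law (k : kind) (B : algebra) : Prop :=
  forall r : B, pat k r -> top r.

Definition trivial_law (B : algebra) : Prop := forall x y : B, x = y.

Definition rho_law (k : kind) (B : algebra) : Prop :=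
  forall r z t : B, pat k r -> z ⊙ t ≼ r -> z ≼ r.

(** For [KC] the pattern is supplied by x + xy itself, so the corresponding identity is η with no
    C(t,u); the same holds for [omega_law], [alpha_law], [mu_law], [iota_law] and [gamma_law]. *)
Definition eta_law (k : kind) (B : algebra) : Prop :=
  forall r x y z : B, pat k r -> x ≼ r -> x ⊙ y ≼ r -> y ⊙ z ≼ r -> z ≼ r.

Definition omega_law (k : kind) (B : algebra) : Prop :=
  forall r x y : B, pat k r -> x ≼ r -> x ⊙ y ≼ r -> y ≼ r.

Definition lambda_law (B : algebra) : Prop :=
  forall r x y z : B, x ≼ r -> y ≼ r -> x ⊙ y ≼ r -> x ⊙ z ≼ r -> z ≼ r.

Definition beta_law (B : algebra) : Prop :=
  forall r x y t z : B, x ≼ r -> x ⊙ y ≼ r -> t ≼ r -> t ⊙ z ≼ r -> x ⊙ z ≼ r.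

Definition path_law (p : forall B : algebra, B -> B -> B -> B -> Prop)
    (B : algebra) : Prop :=
  forall r a b c d : B,
    p B r a b c -> a ⊙ b ≼ r -> b ⊙ c ≼ r -> c ⊙ d ≼ r -> a ⊙ d ≼ r.

Definition delta_law (k : kind) := path_law (fun B r a b c => pat k r).
Definition alpha_law (k : kind) := path_law (fun B r a b c => pat k r /\ a ≼ r).
Definition mu_law (k : kind) := path_law (fun B r a b c => pat k r /\ b ≼ r).
(** Here, as in [kappa_law] and [epsilon_law], two consecutive vertices of the path lie below [r]
    and form a copy of D; hence there is a single kind. *)
Definition mu2_law := path_law (fun B r a b c => b ≼ r /\ c ≼ r).
Definition kappa_law := path_law (fun B r a b c => a ≼ r /\ b ≼ r).
Definition epsilon_law :=
  path_law (fun B r a b c => a ≼ r /\ b ≼ r /\ c ≼ r).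

Definition iota_law (k : kind) (B : algebra) : Prop :=
  forall r x0 x1 x2 x3 x4 x5 : B, pat k r -> x1 ≼ r ->
    x0 ⊙ x1 ≼ r -> x1 ⊙ x2 ≼ r -> x2 ⊙ x3 ≼ r -> x3 ⊙ x4 ≼ r ->
    x4 ⊙ x5 ≼ r -> x0 ⊙ x5 ≼ r.

Definition gamma_law (k : kind) (n : nat) (B : algebra) : Prop :=
  forall (r : B) (f : nat -> B) (y : B), pat k r ->
    f 0 ≼ r -> f (2 * n) ≼ r -> (forall j, j < 2 * n -> f j ⊙ f (S j) ≼ r) ->
    f (2 * n) ⊙ y ≼ r -> f 0 ⊙ y ≼ r.

Definition listed (e : identity) : Prop :=
  In e F25 \/ exists n, 1 <= n /\ (e = id_gamma n \/ e = id_gamma_D n).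

Definition axiomatizable (P : algebra -> Prop) : Prop :=
  exists E, (forall e, In e E -> listed e) /\
    forall B, model B -> (P B <-> forall e, In e E -> satisfies B e).

Lemma ax_iff (P Q : algebra -> Prop) :
  (forall B, model B -> (Q B <-> P B)) -> axiomatizable P -> axiomatizable Q.
Proof.
intros H (E & HE & HP); exists E; split; [exact HE|].
intros B HB; now rewrite (H B HB), (HP B HB).
Qed.

Lemma ax_true (P : algebra -> Prop) :
  (forall B, model B -> P B) -> axiomatizable P.
Proof.
intros H; exists []; split; [now intros e []|].
intros B HB; split; [now intros _ e []|intros _; now apply H].
Qed.

Lemma ax_and (P Q : algebra -> Prop) :
  axiomatizable P -> axiomatizable Q ->
  axiomatizable (fun B => P B /\ Q B).
Proof.
intros (E & HE & HP) (F & HF & HQ); exists (E ++ F); split.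
- intros e He; apply in_app_iff in He as [He|He]; auto.
- intros B HB; rewrite (HP B HB), (HQ B HB); split.
  + intros [H1 H2] e He; apply in_app_iff in He as [He|He]; auto.
  + intros H; split; intros e He; apply H, in_app_iff; auto.
Qed.

Lemma ax_forall_in (T : Type) (P : T -> algebra -> Prop) (l : list T) :
  (forall m, In m l -> axiomatizable (P m)) ->
  axiomatizable (fun B => forall m, In m l -> P m B).
Proof.
induction l as [|m l IH]; intros H; [now apply ax_true|].
apply ax_iff with (fun B => P m B /\ forall n, In n l -> P n B).
- intros B _; simpl; split.
  + intros H'; split; [|intros n Hn]; apply H'; tauto.
  + intros [H1 H2] n [<-|Hn]; auto.
- apply ax_and; [apply H; now left|apply IH; intros n Hn; apply H; now right].
Qed.

Lemma ax_listed (e : identity) (P : algebra -> Prop) :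
  listed e -> (forall B, model B -> (P B <-> satisfies B e)) ->
  axiomatizable P.
Proof.
intros He H; exists [e]; split; [now intros e' [<-|[]]|].
intros B HB; rewrite (H B HB); split; [now intros H' e' [<-|[]]|].
intros H'; apply H'; now left.
Qed.

(** * Matching each law with a listed identity *)

Definition letters9 {B : algebra} (x y z t u a b c d : B) (i : nat) : B :=
  match i with
  | 0 => x | 1 => y | 2 => z | 3 => t | 4 => u
  | 5 => a | 6 => b | 7 => c | _ => d
  end.

Ltac in_list := left; unfold F25; simpl; tauto.

Ltac unfold_ids := unfold id_rho, id_eta, id_omega, id_zeta, id_lambda,
  id_eta_D, id_omega_D, id_zeta_D, id_mu, id_nu, id_mu2, id_mu_D, id_nu_D,
  id_delta, id_xi, id_beta, id_s, id_chi, id_tau, id_alpha, id_alpha_D,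
  id_epsilon, id_kappa, id_iota2, id_iota2_D, Ct, Dt, Lt in *.

Ltac below_sum HB := solve
  [ assumption
  | apply (le_refl HB)
  | lazymatch goal with |- _ ≼ add _ _ =>
      first [apply (le_addr HB); below_sum HB|apply (le_addl HB); below_sum HB]
    end ].

Ltac sum_below HB := repeat
  lazymatch goal with |- add _ _ ≼ _ => apply (add_le HB); split end;
  try assumption.

Ltac use_identity HB H v :=
  apply (le_trans HB) with (1 := H v); unfold_ids;
  cbn [lhs rhs eval tsum Nat.add letters9]; sum_below HB.

Ltac pat_in_sum HB p q := exists p, q; repeat apply conj; try exact I; below_sum HB.

Ltac intro_sum v :=
  intros v; unfold_ids; cbn [lhs rhs eval tsum Nat.add];
  lazymatch goal with |- add ?m ?r = ?r => change (m ≼ r) end.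

Lemma ax_zero (k : kind) : axiomatizable (zero_law k).
Proof.
destruct k; [apply ax_listed with id_chi|apply ax_listed with id_s
  |apply ax_listed with id_xi]; try in_list.
all: intros B HB; unfold_ids; rewrite (satisfies_eq B HB); split.
all: try (intros H; split;
  [intro_sum v; apply H; pat_in_sum HB (v 0) (v 1)|intros v; apply (top_sqr HB)]).
all: intros [H _] r (x & y & Hr); apply (sqr_le HB x);
  use_identity HB H (letters9 x y x x x x x x x); tauto.
Qed.

Lemma ax_trivial : axiomatizable trivial_law.
Proof.
apply ax_listed with id_tau; [in_list|]; intros B HB; split.
- intros H v; apply H.
- intros H x y; exact (H (letters9 x y y y y y y y y)).
Qed.

Lemma ax_rho (k : kind) : axiomatizable (rho_law k).
Proof.
destruct k; [apply ax_listed with id_rho|apply ax_listed with id_zeta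
  |apply ax_listed with id_zeta_D]; try in_list.
all: intros B HB; split; intros H.
1: intro_sum v; apply (H _ _ (v 1)); [pat_in_sum HB (v 0) (v 1)|below_sum HB].
2,4: intro_sum v; apply (H _ _ (v 3));
  [pat_in_sum HB (v 0) (v 1)|below_sum HB].
all: intros r z t (x & y & Hr) Hzt.
- use_identity HB H (letters9 z t t t t t t t t).
- use_identity HB H (letters9 x y z t t t t t t); tauto.
- use_identity HB H (letters9 x y z t t t t t t); tauto.
Qed.

Lemma ax_eta (k : kind) : k <> KN -> axiomatizable (eta_law k).
Proof.
destruct k; [easy| |]; intros _;
  [apply ax_listed with id_eta|apply ax_listed with id_eta_D]; try in_list.
all: intros B HB; split; intros H.
1: intro_sum v; apply (H _ (v 0) (v 1));
  [pat_in_sum HB (v 0) (v 1)|below_sum HB ..].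
2: intro_sum v; apply (H _ (v 0) (v 1));
  [pat_in_sum HB (v 3) (v 4)|below_sum HB ..].
all: intros r x y z (t & u & Hr) Hx Hxy Hyz;
  use_identity HB H (letters9 x y z t u z z z z); tauto.
Qed.

Lemma ax_omega (k : kind) : k <> KN -> axiomatizable (omega_law k).
Proof.
destruct k; [easy| |]; intros _;
  [apply ax_listed with id_omega|apply ax_listed with id_omega_D]; try in_list.
all: intros B HB; split; intros H.
1: intro_sum v; apply (H _ (v 0) (v 1));
  [pat_in_sum HB (v 0) (v 1)|below_sum HB ..].
2: intro_sum v; apply (H _ (v 0) (v 1));
  [pat_in_sum HB (v 3) (v 4)|below_sum HB ..].
all: intros r x y (t & u & Hr) Hx Hxy;
  use_identity HB H (letters9 x y y t u y y y y); tauto.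
Qed.

Lemma ax_lambda : axiomatizable lambda_law.
Proof.
apply ax_listed with id_lambda; [in_list|]; intros B HB; split; intros H.
- intro_sum v; apply (H _ (v 0) (v 1)); below_sum HB.
- intros r x y z ? ? ? ?; use_identity HB H (letters9 x y z z z z z z z).
Qed.

Lemma ax_beta : axiomatizable beta_law.
Proof.
apply ax_listed with id_beta; [in_list|]; intros B HB; split; intros H.
- intro_sum v; apply (H _ (v 0) (v 1) (v 3) (v 2)); below_sum HB.
- intros r x y t z ? ? ? ?; use_identity HB H (letters9 x y z t z z z z z).
Qed.

Lemma ax_delta (k : kind) : axiomatizable (delta_law k).
Proof.
destruct k; [apply ax_listed with id_delta|apply ax_listed with id_nu
  |apply ax_listed with id_nu_D]; try in_list.
all: intros B HB; split; intros H.
1: intro_sum v; apply (H _ (v 5) (v 6) (v 7) (v 8));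
  [pat_in_sum HB (v 5) (v 6)|below_sum HB ..].
2,4: intro_sum v; apply (H _ (v 5) (v 6) (v 7) (v 8));
  [pat_in_sum HB (v 3) (v 4)|below_sum HB ..].
all: intros r a b c d (t & u & Hr) ? ? ?;
  use_identity HB H (letters9 a a a t u a b c d); tauto.
Qed.

Lemma ax_mu (k : kind) : k <> KN -> axiomatizable (mu_law k).
Proof.
destruct k; [easy| |]; intros _;
  [apply ax_listed with id_mu|apply ax_listed with id_mu_D]; try in_list.
all: intros B HB; split; intros H.
1: intro_sum v; apply (H _ (v 5) (v 6) (v 7) (v 8));
  [split;
  [pat_in_sum HB (v 6) (v 7)|below_sum HB]|below_sum HB ..].
2: intro_sum v; apply (H _ (v 5) (v 6) (v 7) (v 8));
  [split;
  [pat_in_sum HB (v 3) (v 4)|below_sum HB]|below_sum HB ..].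
all: intros r a b c d [(t & u & Hr) ?] ? ? ?;
  use_identity HB H (letters9 a a a t u a b c d); tauto.
Qed.

Lemma ax_alpha (k : kind) : k <> KN -> axiomatizable (alpha_law k).
Proof.
destruct k; [easy| |]; intros _;
  [apply ax_listed with id_alpha|apply ax_listed with id_alpha_D]; try in_list.
all: intros B HB; split; intros H.
1: intro_sum v; apply (H _ (v 5) (v 6) (v 7) (v 8));
  [split;
  [pat_in_sum HB (v 5) (v 6)|below_sum HB]|below_sum HB ..].
2: intro_sum v; apply (H _ (v 5) (v 6) (v 7) (v 8));
  [split;
  [pat_in_sum HB (v 3) (v 4)|below_sum HB]|below_sum HB ..].
all: intros r a b c d [(t & u & Hr) ?] ? ? ?;
  use_identity HB H (letters9 a a a t u a b c d); tauto.
Qed.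

Lemma ax_mu2 : axiomatizable mu2_law.
Proof.
apply ax_listed with id_mu2; [in_list|]; intros B HB; split; intros H.
- intro_sum v; apply (H _ (v 5) (v 6) (v 7) (v 8));
    [repeat apply conj; below_sum HB|below_sum HB ..].
- intros r a b c d Hr ? ? ?; use_identity HB H (letters9 a a a a a a b c d);
    tauto.
Qed.

Lemma ax_kappa : axiomatizable kappa_law.
Proof.
apply ax_listed with id_kappa; [in_list|]; intros B HB; split; intros H.
- intro_sum v; apply (H _ (v 5) (v 6) (v 7) (v 8));
    [repeat apply conj; below_sum HB|below_sum HB ..].
- intros r a b c d Hr ? ? ?; use_identity HB H (letters9 a a a a a a b c d);
    tauto.
Qed.

Lemma ax_epsilon : axiomatizable epsilon_law.
Proof.
apply ax_listed with id_epsilon; [in_list|]; intros B HB; split; intros H.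
- intro_sum v; apply (H _ (v 5) (v 6) (v 7) (v 8));
    [repeat apply conj; below_sum HB|below_sum HB ..].
- intros r a b c d Hr ? ? ?; use_identity HB H (letters9 a a a a a a b c d);
    tauto.
Qed.

Definition iota_letters {B : algebra} (t u x0 x1 x2 x3 x4 x5 : B) (i : nat) : B :=
  match i with
  | 3 => t | 4 => u
  | 9 => x0 | 10 => x1 | 11 => x2 | 12 => x3 | 13 => x4 | _ => x5
  end.

Lemma ax_iota (k : kind) : k <> KN -> axiomatizable (iota_law k).
Proof.
destruct k; [easy| |]; intros _;
  [apply ax_listed with id_iota2|apply ax_listed with id_iota2_D]; try in_list.
all: intros B HB; split; intros H.
1: intro_sum v; apply (H _ (v 9) (v 10) (v 11) (v 12) (v 13) (v 14));
  [pat_in_sum HB (v 10) (v 11)|below_sum HB ..].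
2: intro_sum v; apply (H _ (v 9) (v 10) (v 11) (v 12) (v 13) (v 14));
  [pat_in_sum HB (v 3) (v 4)|below_sum HB ..].
all: intros r x0 x1 x2 x3 x4 x5 (t & u & Hr) ? ? ? ? ? ?;
  use_identity HB H (iota_letters t u x0 x1 x2 x3 x4 x5);
  cbn [iota_letters]; tauto.
Qed.

Lemma eval_tsum_le (B : algebra) (HB : model B) (v : nat -> B) (r : B)
    (f : nat -> term) (m : nat) :
  eval B v (tsum f m) ≼ r <-> forall j, j <= m -> eval B v (f j) ≼ r.
Proof.
induction m as [|m IH]; cbn [tsum eval].
- split; [|intros H; now apply H].
  intros H j Hj; now replace j with 0 by lia.
- rewrite (add_le HB), IH; split.
  + intros [H1 H2] j Hj.
    destruct (Nat.eq_dec j (S m)) as [->|]; [exact H2|apply H1; lia].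
  + intros H; split; [intros j Hj|]; apply H; lia.
Qed.

Definition gamma_letters {B : algebra} (y t u : B) (f : nat -> B) (i : nat) : B :=
  match i with
  | 1 => y | 3 => t | 4 => u | _ => f (i - 9)
  end.

Lemma gamma_lettersE (B : algebra) (y t u : B) (f : nat -> B) (j : nat) :
  gamma_letters y t u f (9 + j) = f j.
Proof. now simpl; rewrite Nat.sub_0_r. Qed.

Lemma ax_gamma (k : kind) (n : nat) :
  k <> KN -> 1 <= n -> axiomatizable (gamma_law k n).
Proof.
intros Hk Hn.
apply ax_listed with (match k with KD => id_gamma_D n | _ => id_gamma n end).
{ right; exists n; destruct k; auto. }
intros B HB; split; intros H.
- assert (H' : forall (v : nat -> B) r, pat k r -> v 9 ≼ r ->
    v (9 + 2 * n) ≼ r ->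
    eval B v (tsum (fun j => Mul (Var (9 + j)) (Var (9 + (j + 1)))) (2 * n - 1))
      ≼ r ->
    v (9 + 2 * n) ⊙ v 1 ≼ r -> v 9 ⊙ v 1 ≼ r).
  { intros v r Hr H0 H2n Hs Hy; apply (H r (fun j => v (9 + j))); auto.
    intros j Hj; rewrite (eval_tsum_le B HB) in Hs.
    specialize (Hs j); cbn [eval] in Hs.
    rewrite (Nat.add_1_r j) in Hs; apply Hs; lia. }
  destruct k; [easy| |]; unfold id_gamma, id_gamma_D, Dt;
    intros v; cbn [lhs rhs eval];
    lazymatch goal with |- add ?m ?r = ?r => change (m ≼ r) end; apply H';
    try below_sum HB.
  + unfold pat; exists (v (9 + 2 * n)), (v 1); split; below_sum HB.
  + pat_in_sum HB (v 3) (v 4).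
- intros r f y (t & u & Hr) H0 H2n Hs Hy.
  assert (Hs' : eval B (gamma_letters y t u f)
    (tsum (fun j => Mul (Var (9 + j)) (Var (9 + (j + 1)))) (2 * n - 1)) ≼ r).
  { apply (eval_tsum_le B HB); intros j Hj; cbn [eval].
    rewrite !gamma_lettersE, Nat.add_1_r; apply Hs; lia. }
  destruct k; [easy| |]; specialize (H (gamma_letters y t u f));
    unfold id_gamma, id_gamma_D, Dt in H; cbn [lhs rhs eval] in H;
    rewrite !gamma_lettersE in H;
    apply (le_trans HB) with (1 := H); sum_below HB; tauto.
Qed.

(** * Walks in bipartite graphs *)

Section Graph.

Variables (L : nat -> Prop) (E : nat -> nat -> Prop).
Hypothesis E_sym : forall x y, E x y -> E y x.

Inductive walk : nat -> nat -> nat -> Prop :=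
| walk_nil x : walk 0 x x
| walk_cons n x y z : E x y -> walk n y z -> walk (S n) x z.

Definition conn (x y : nat) : Prop := exists n, walk n x y.

Definition vertex (x : nat) : Prop := exists y, E x y.

Definition bip (col : nat -> bool) : Prop :=
  forall x y, E x y -> col y = negb (col x).

Lemma walk_0 x y : walk 0 x y -> x = y.
Proof. now inversion 1. Qed.

Lemma walk_S n x z : walk (S n) x z -> exists y, E x y /\ walk n y z.
Proof. inversion 1; eauto. Qed.

Lemma walk_cat m n x y z : walk m x y -> walk n y z -> walk (m + n) x z.
Proof.
induction 1 as [|m x x' y H _ IH]; simpl; auto.
intros Hz; apply walk_cons with x'; auto.
Qed.

Lemma walk1 x y : E x y -> walk 1 x y.
Proof. intros H; apply walk_cons with y; [exact H|apply walk_nil]. Qed.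

Lemma walk_rev n x y : walk n x y -> walk n y x.
Proof.
induction 1 as [|n x x' y H _ IH]; [apply walk_nil|].
rewrite <- Nat.add_1_r; apply walk_cat with x'; auto using walk1.
Qed.

Lemma walk_rcons n x y z : walk n x y -> E y z -> walk (S n) x z.
Proof.
intros H Hz; rewrite <- Nat.add_1_r; apply walk_cat with y; auto using walk1.
Qed.

Lemma walk2 x y z : E x y -> E y z -> walk 2 x z.
Proof. intros H; apply walk_rcons, walk1, H. Qed.

Lemma walk2_inv x z : walk 2 x z -> exists y, E x y /\ E y z.
Proof.
intros H; apply walk_S in H as (y & H1 & H2).
apply walk_S in H2 as (y' & H2 & H3); apply walk_0 in H3 as <-; eauto.
Qed.

(* A walk can bounce along its first edge. *)
Lemma walk_pad j i x y : vertex x -> walk i x y -> walk (i + 2 * j) x y.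
Proof.
intros [z Hz] H; induction j as [|j IH].
- now replace (i + 2 * 0) with i by lia.
- replace (i + 2 * S j) with (S (S (i + 2 * j))) by lia.
  apply walk_cons with z, walk_cons with x; auto.
Qed.

Lemma walk_seq n x y :
  walk n x y ->
  exists f, f 0 = x /\ f n = y /\ forall j, j < n -> E (f j) (f (S j)).
Proof.
induction 1 as [x|n x x' y H _ (f & H0 & Hn & Hf)].
- exists (fun _ => x); repeat split; lia.
- exists (fun j => match j with 0 => x | S i => f i end).
  repeat split; auto.
  intros [|j] Hj; [now rewrite H0|apply Hf; lia].
Qed.

Lemma even_walk_ind (P : nat -> Prop) j x y :
  (forall u s w, P u -> E u s -> E s w -> P w) ->
  P x -> walk (2 * j) x y -> P y.
Proof.
intros HP; revert x; induction j as [|j IH]; intros x Hx H.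
- now apply walk_0 in H as <-.
- replace (2 * S j) with (S (S (2 * j))) in H by lia.
  apply walk_S in H as (s & H1 & H2); apply walk_S in H2 as (w & H2 & H3).
  eauto.
Qed.

Lemma conn_refl x : conn x x.
Proof. exists 0; apply walk_nil. Qed.

Lemma conn_sym x y : conn x y -> conn y x.
Proof. intros [n H]; exists n; now apply walk_rev. Qed.

Lemma conn_trans x y z : conn x y -> conn y z -> conn x z.
Proof. intros [m H] [n H']; exists (m + n); now apply walk_cat with y. Qed.

Lemma conn_edge x y z : conn x y -> E y z -> conn x z.
Proof. intros [n H] Hz; exists (S n); now apply walk_rcons with y. Qed.

Lemma conn_vertex x y : conn x y -> vertex y -> vertex x.
Proof. intros [n H]; destruct H as [|n x x' y H]; auto; now exists x'. Qed.

Section Coloring.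

Variable col : nat -> bool.
Hypothesis Hcol : bip col.

Lemma walk_col n x y : walk n x y -> col y = xorb (Nat.odd n) (col x).
Proof.
induction 1 as [|n x x' y H _ ->]; [now destruct (col x)|].
rewrite Nat.odd_succ, <- Nat.negb_odd, (Hcol _ _ H).
now destruct (Nat.odd n), (col x).
Qed.

Lemma conn_even x y : conn x y -> col x = col y -> exists j, walk (2 * j) x y.
Proof.
intros [n H] Hxy; assert (He := walk_col n x y H).
destruct (Nat.Even_or_Odd n) as [[j ->]|Ho]; [eauto|].
apply Nat.odd_spec in Ho; rewrite Ho in He; destruct (col x), (col y); easy.
Qed.

Lemma conn_odd x y :
  conn x y -> col x <> col y -> exists s j, E x s /\ walk (2 * j) s y.
Proof.
intros [n H] Hxy; destruct H as [|n x s y Hs H]; [easy|].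
destruct (conn_even s y) as [j Hj]; [now exists n| |eauto].
rewrite (Hcol _ _ Hs); destruct (col x), (col y); easy.
Qed.

Lemma flip_bip (P : nat -> Prop) :
  (forall x y, E x y -> P x <-> P y) ->
  bip (fun x => if dec (P x) then negb (col x) else col x).
Proof.
intros HP x y H; specialize (HP x y H); rewrite (Hcol x y H).
destruct (dec (P x)), (dec (P y)); tauto.
Qed.

End Coloring.

Lemma conn_edge_iff x u w : E u w -> conn x u <-> conn x w.
Proof. intros H; split; intros H'; eauto using conn_edge. Qed.

(** * Inequalities as implications over a graph *)

Definition below {B : algebra} (v : nat -> B) (r : B) : Prop :=
  (forall x, L x -> v x ≼ r) /\ (forall x y, E x y -> v x ⊙ v y ≼ r).

Definition horn (m : mon) (B : algebra) : Prop :=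
  forall (v : nat -> B) r, below v r -> mle v m r.

(** Phrased by an odd walk rather than by colours, so that it survives recolouring of components. *)
Definition two_sided (x : nat) : Prop :=
  exists w w' n, L w /\ L w' /\ conn x w /\ walk n w w' /\ Nat.odd n = true.

(** The kind is chosen so that its pattern both occurs below every [r] above s ([pat_below]) and
    receives the whole graph of s ([fold_pat]). *)
Definition has_kind (k : kind) : Prop :=
  match k with
  | KN => forall x, L x -> ~ vertex x
  | KC => (exists x, L x /\ vertex x) /\ forall x, ~ two_sided x
  | KD => exists x, two_sided x
  end.

(** In C(t,u) only one end of the edge is a letter; for [KC] all letters must therefore share the
    colour that is sent to that end. *)
Definition fits (k : kind) (col : nat -> bool) : Prop :=
  bip col /\ (k = KC -> forall x, L x -> col x = true).

Lemma has_kind_exists : exists k, has_kind k.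
Proof.
destruct (classic (exists x, two_sided x)) as [H|H]; [now exists KD|].
destruct (classic (exists x, L x /\ vertex x)) as [H'|H'].
- exists KC; simpl; split; [exact H'|intros x Hx; eauto].
- exists KN; simpl; intros x H1 H2; eauto.
Qed.

Lemma two_sided_intro col x w w' :
  bip col -> L w -> L w' -> conn x w -> conn x w' -> col w <> col w' ->
  two_sided x.
Proof.
intros Hcol Hw Hw' Hc Hc' Hne.
destruct (conn_odd col Hcol w w') as (s & j & Hs & Hj); auto.
{ apply conn_trans with x; auto using conn_sym. }
exists w, w', (S (2 * j)); repeat split; auto.
- now apply walk_cons with s.
- now rewrite Nat.odd_succ, Nat.even_mul.
Qed.

Lemma fits_exists col k : bip col -> has_kind k -> exists col', fits k col'.
Proof.
intros Hcol Hk.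
destruct k; try (exists col; split; [exact Hcol|easy]).
destruct Hk as [_ Hk].
(* Flip exactly the components with a letter of colour false; no component is two-sided, so no
   letter of the other colour is spoiled. *)
exists (fun x => if dec (exists w, L w /\ conn x w /\ col w = false)
                 then negb (col x) else col x); split.
- apply (flip_bip col Hcol (fun x => exists w, L w /\ conn x w /\ col w = false)).
  intros x y H; split; intros (w & Hw & Hc & Hf); exists w; repeat split; auto.
  + apply conn_trans with x; auto; apply conn_edge with y; auto using conn_refl.
  + apply conn_trans with y; auto; apply conn_edge with x; auto using conn_refl.
- intros _ x Hx; destruct dec as [(w & Hw & Hc & Hf)|H].
  + destruct (col x) eqn:Hcx; [|easy]; exfalso; apply (Hk x).
    apply (two_sided_intro col x x w); auto using conn_refl; congruence.
  + destruct (col x) eqn:Hcx; [easy|]; exfalso; apply H.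
    exists x; auto using conn_refl.
Qed.

(** * Axiomatizability of a single inequality *)

(** This comes from the identities of [R12] ([letters_odd_walk]); it is assumed here because the
    section sees s only through [L] and [E]. *)
Hypothesis below_odd : forall B, model B -> forall (v : nat -> B) r n x y,
  below v r -> L x -> L y -> walk n x y -> Nat.odd n = true -> v x ⊙ v y ≼ r.

Variable k : kind.
Hypothesis Hk : has_kind k.
Variable col0 : nat -> bool.
Hypothesis Hfit : fits k col0.
Hypothesis nonempty : exists x y, E x y.

Let Hcol0 : bip col0 := proj1 Hfit.

Lemma below_opposite (B : algebra) (HB : model B) (v : nat -> B) r x y :
  below v r -> L x -> L y -> conn x y -> col0 x <> col0 y -> v x ⊙ v y ≼ r.
Proof.
intros Hv Hx Hy Hc Hne.
destruct (conn_odd col0 Hcol0 x y Hc Hne) as (s & j & Hs & Hj).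
apply (below_odd B HB v r (S (2 * j))); auto.
- now apply walk_cons with s.
- now rewrite Nat.odd_succ, Nat.even_mul.
Qed.

Lemma pat_below (B : algebra) (HB : model B) (v : nat -> B) r :
  below v r -> pat k r.
Proof.
intros Hv; destruct k; simpl in Hk.
- destruct nonempty as (x & y & H); exists (v x), (v y); split; [now apply Hv|easy].
- destruct Hk as [(x & Hx & y & H) _]; exists (v x), (v y); split; now apply Hv.
- destruct Hk as (x & w & w' & n & Hw & Hw' & Hc & Hn & Ho).
  exists (v w), (v w'); split; [|split; now apply Hv].
  now apply (below_odd B HB v r n).
Qed.

(* The graph folds onto the pattern below [r]. *)
Lemma fold_pat (B : algebra) (HB : model B) (r : B) (col : nat -> bool) :
  fits k col -> pat k r ->
  exists g, below g r /\
    forall x y, vertex x -> vertex y -> col x = col y -> g x = g y.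
Proof.
intros [Hcol HL] (p & q & Hpq & Hp).
assert (He : forall x y, E x y -> (if col x then p else q) ⊙
               (if col y then p else q) ≼ r).
{ intros x y H; rewrite (Hcol x y H); destruct (col x); simpl; auto.
  now apply (le_mulC HB). }
(* Variables outside the graph, including isolated letters, go to [p ⊙ q], which is below [r] in
   every kind. *)
exists (fun x => if dec (vertex x) then if col x then p else q else p ⊙ q).
split; [split|].
- intros x Hx; destruct dec as [Vx|]; [|exact Hpq].
  destruct k; simpl in Hk.
  + now contradiction (Hk x).
  + now rewrite (HL eq_refl x Hx).
  + destruct (col x); tauto.
- intros x y H; destruct dec as [|n]; [|exfalso; apply n; now exists y].
  destruct dec as [|n]; [|exfalso; apply n; exists x; auto].
  now apply He.
- intros x y Vx Vy Hxy; rewrite Hxy; now destruct dec, dec.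
Qed.

(* The rest of the graph folds onto the pattern; the edges of [R] are oriented
   by their colors. *)
Lemma fold_region (B : algebra) (HB : model B) (r : B) (R : nat -> Prop)
    (h : nat -> B) (m : mon) (c : bool) :
  (forall x y, E x y -> R x -> R y) -> pat k r -> horn m B ->
  (forall x, R x -> L x -> h x ≼ r) ->
  (forall x y, R x -> R y -> E x y -> col0 x = c -> col0 y <> c ->
     h x ⊙ h y ≼ r) ->
  match m with
  | M0 => True
  | M1 x => R x -> h x ≼ r
  | M2 x y => R x -> R y -> h x ⊙ h y ≼ r
  end.
Proof.
intros HR Hr Hm HL HE'.
assert (HE : forall x y, R x -> R y -> E x y -> h x ⊙ h y ≼ r).
{ intros x y Rx Ry H; assert (Hc := Hcol0 x y H).
  destruct (Bool.bool_dec (col0 x) c) as [Hx|Hx].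
  - apply HE'; auto; destruct (col0 x), c; simpl in *; congruence.
  - apply (le_mulC HB), HE'; auto; destruct (col0 x), c; simpl in *; congruence. }
destruct (fold_pat B HB r col0 Hfit Hr) as (g & Hg & _).
assert (Hv : below (fun x => if dec (R x) then h x else g x) r).
{ split.
  - intros x Hx; destruct dec; [auto|now apply Hg].
  - intros x y H; destruct (dec (R x)), (dec (R y)); auto; try now apply Hg.
    + exfalso; eauto.
    + exfalso; eauto. }
apply Hm in Hv; destruct m as [|x|x y]; simpl in Hv; auto.
- now destruct dec.
- now destruct dec, dec.
Qed.

(** If some fold turns m into a product of three factors, a square, or anything else forcing [r] to
    be greatest, the inequality is the strongest one compatible with the pattern, and the zero law
    gives it back. *)
Lemma ax_zero_horn (m : mon) :
  (forall B, model B -> forall r : B, pat k r ->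
     exists g, below g r /\ (mle g m r -> top r)) ->
  axiomatizable (horn m).
Proof.
intros H; apply ax_iff with (zero_law k); [|apply ax_zero].
intros B HB; split.
- intros Hm r Hr; destruct (H B HB r Hr) as (g & Hg & Ht); auto.
- intros Hz v r Hv; assert (T := Hz r (pat_below B HB v r Hv)).
  destruct m; simpl; auto.
Qed.

Lemma ax_M0 : axiomatizable (horn M0).
Proof.
apply ax_zero_horn; intros B HB r Hr.
destruct (fold_pat B HB r col0 Hfit Hr) as (g & Hg & _); eauto.
Qed.

(** Folding identifies x and y, so their product becomes a square. Any fitting colouring is allowed,
    in particular [col0] with one component flipped. *)
Lemma ax_same_color col x y :
  fits k col -> vertex x -> vertex y -> col x = col y ->
  axiomatizable (horn (M2 x y)).
Proof.
intros Hf Vx Vy Hxy; apply ax_zero_horn; intros B HB r Hr.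
destruct (fold_pat B HB r col Hf Hr) as (g & Hg & Heq).
exists g; split; [exact Hg|]; simpl; rewrite (Heq x y Vx Vy Hxy).
apply (sqr_le HB).
Qed.

Lemma ax_sqr x : axiomatizable (horn (M2 x x)).
Proof.
apply ax_zero_horn; intros B HB r Hr.
destruct (fold_pat B HB r col0 Hfit Hr) as (g & Hg & _).
exists g; split; [exact Hg|apply (sqr_le HB)].
Qed.

Lemma horn_sym (B : algebra) (HB : model B) x y :
  horn (M2 x y) B -> horn (M2 y x) B.
Proof. intros H v r Hv; apply (le_mulC HB), (H v r Hv). Qed.

Lemma ax_sym x y : axiomatizable (horn (M2 x y)) -> axiomatizable (horn (M2 y x)).
Proof.
apply ax_iff; intros B HB; split; now apply horn_sym.
Qed.

(** With no edge at x, x may be sent to [p ⊙ q], even if it is a letter; its product with another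
    variable then has three factors. *)
Lemma ax_not_vertex x y : ~ vertex x -> axiomatizable (horn (M2 x y)).
Proof.
intros Vx; destruct (Nat.eq_dec x y) as [<-|Hne]; [apply ax_sqr|].
apply ax_zero_horn; intros B HB r Hr.
destruct (fold_pat B HB r col0 Hfit Hr) as (g & Hg & _).
destruct Hr as (p & q & Hpq & _).
exists (fun z => if Nat.eq_dec z x then p ⊙ q else g z); split; [split|].
- intros z Hz; destruct Nat.eq_dec; [exact Hpq|now apply Hg].
- intros z w H; destruct (Nat.eq_dec z x) as [->|].
  { exfalso; apply Vx; now exists w. }
  destruct (Nat.eq_dec w x) as [->|]; [|now apply Hg].
  exfalso; apply Vx; exists z; auto.
- simpl; destruct (Nat.eq_dec x x), (Nat.eq_dec y x); try congruence.
  apply (mul3_le HB).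
Qed.

(** * A letter below a term *)

Ltac eval_dec := repeat match goal with
  | |- context [if ?d then _ else _] =>
      destruct d; try congruence; try contradiction
  end.

(** The law depends on where the component of z carries letters: λ if on both sides, η if only on
    the side of z, ω if only on the opposite side, ρ or its variants if there are none. *)
Lemma ax_M1 z : axiomatizable (horn (M1 z)).
Proof.
destruct (classic (L z)) as [Lz|Lz].
{ apply ax_true; intros B HB v r Hv; now apply Hv. }
destruct (classic (vertex z)) as [Vz|Vz]; cycle 1.
{   apply ax_zero_horn; intros B HB r Hr.
  destruct (fold_pat B HB r col0 Hfit Hr) as (g & Hg & _).
  exists (fun x => if Nat.eq_dec x z then r ⊙ r else g x); split; [split|].
  - intros x Hx; destruct Nat.eq_dec; [congruence|now apply Hg].
  - intros x y H; destruct (Nat.eq_dec x z) as [->|].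
    { exfalso; apply Vz; now exists y. }
    destruct (Nat.eq_dec y z) as [->|]; [|now apply Hg].
    exfalso; apply Vz; exists x; auto.
  - simpl; destruct (Nat.eq_dec z z); [apply (sqr_le HB)|easy]. }
assert (HR : forall x y, E x y -> conn z x -> conn z y)
  by (intros x y H H'; now apply conn_edge with x).
destruct (classic (exists w, L w /\ conn w z /\ col0 w = col0 z)) as [S|S],
  (classic (exists w, L w /\ conn w z /\ col0 w <> col0 z)) as [O|O].
- apply ax_iff with lambda_law; [|apply ax_lambda].
  destruct S as (w & Lw & Cw & Ew), O as (w' & Lw' & Cw' & Ew').
  intros B HB; split.
  + intros H r x y p Hx Hy Hxy Hxp.
    assert (HD : pat k r).
    { exists x, y; destruct k; auto. }
    (* As z is not a letter, it can be separated from its side and sent alone to [p]. *)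
    pose (h u := if Nat.eq_dec u z then p else
                 if Bool.bool_dec (col0 u) (col0 z) then y else x).
    assert (H0 : h z ≼ r); [|revert H0; unfold h; eval_dec; auto].
    apply (fold_region B HB r (conn z) h (M1 z) (col0 z)); auto using conn_refl.
    * intros u _ Lu; unfold h; eval_dec; assumption.
    * intros u u' _ _ H' Hu Hu'; unfold h.
      eval_dec; auto; now apply (le_mulC HB).
  + intros Hl v r Hv; simpl.
    (* λ moves a pair of elements below [r] with product below [r] along the walk: from w, w' to the
       next vertex and w. *)
    assert (H : forall n w w', v w ≼ r -> v w' ≼ r -> v w ⊙ v w' ≼ r ->
                  walk n w z -> v z ≼ r).
    { clear - HB Hl Hv; induction n as [|n IH]; intros w w' H1 H2 H12 H.
      - now apply walk_0 in H as <-.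
      - apply walk_S in H as (u & Hu & Hw).
        assert (v w ⊙ v u ≼ r) by now apply Hv.
        apply (IH u w); auto; [now apply (Hl r (v w) (v w'))|].
        now apply (le_mulC HB). }
    destruct Cw as [n Hn]; apply (H n w w'); try (now apply Hv); auto.
    apply (below_opposite B HB); auto; [|congruence].
    apply conn_trans with z; [now exists n|now apply conn_sym].
- assert (Hkn : k <> KN).
  { intros ->; destruct S as (w & Lw & Cw & _); apply (Hk w Lw).
    now apply conn_vertex with z. }
  apply ax_iff with (eta_law k); [|now apply ax_eta].
  intros B HB; split.
  + intros H r x y p Hr Hx Hxy Hyp.
    pose (h u := if Nat.eq_dec u z then p else
                 if Bool.bool_dec (col0 u) (col0 z) then x else y).
    assert (H0 : h z ≼ r); [|revert H0; unfold h; eval_dec; auto].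
    apply (fold_region B HB r (conn z) h (M1 z) (col0 z)); auto using conn_refl.
    * intros u Cu Lu; unfold h; eval_dec; auto.
      exfalso; apply O; exists u; auto using conn_sym.
    * intros u u' _ _ H' Hu Hu'; unfold h.
      eval_dec; auto; now apply (le_mulC HB).
  + intros Hl v r Hv; simpl.
    destruct S as (w & Lw & Cw & Ew).
    destruct (conn_even col0 Hcol0 w z Cw Ew) as [j Hj].
    apply (even_walk_ind (fun u => v u ≼ r) j w z); auto; [|now apply Hv].
    intros u s u' Hu H1 H2; apply (Hl r (v u) (v s)); auto; try (now apply Hv).
    now apply (pat_below B HB v).
- assert (Hkn : k <> KN).
  { intros ->; destruct O as (w & Lw & Cw & _); apply (Hk w Lw).
    now apply conn_vertex with z. }
  apply ax_iff with (omega_law k); [|now apply ax_omega].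
  intros B HB; split.
  + intros H r x y Hr Hx Hxy.
    pose (h u := if Bool.bool_dec (col0 u) (col0 z) then y else x).
    assert (H0 : h z ≼ r); [|revert H0; unfold h; eval_dec; auto].
    apply (fold_region B HB r (conn z) h (M1 z) (col0 z)); auto using conn_refl.
    * intros u Cu Lu; unfold h; destruct Bool.bool_dec; auto.
      exfalso; apply S; exists u; auto using conn_sym.
    * intros u u' _ _ H' Hu Hu'; unfold h.
      eval_dec; auto; now apply (le_mulC HB).
  + intros Hl v r Hv; simpl.
    destruct O as (w & Lw & [n Hn] & _).
    assert (H : forall n w, v w ≼ r -> walk n w z -> v z ≼ r);
      [|apply (H n w); auto; now apply Hv].
    clear w n Lw Hn; induction n as [|n IH]; intros w Hw H.
    * now apply walk_0 in H as <-.
    * apply walk_S in H as (u & Hu & H); apply (IH u); auto.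
      apply (Hl r (v w)); auto; [now apply (pat_below B HB v)|now apply Hv].
- apply ax_iff with (rho_law k); [|apply ax_rho].
  intros B HB; split.
  + intros H r p t Hr Hpt.
    pose (h u := if Bool.bool_dec (col0 u) (col0 z) then p else t).
    assert (H0 : h z ≼ r); [|revert H0; unfold h; eval_dec; auto].
    apply (fold_region B HB r (conn z) h (M1 z) (col0 z)); auto using conn_refl.
    * intros u Cu Lu; exfalso; apply conn_sym in Cu.
      destruct (Bool.bool_dec (col0 u) (col0 z)); eauto.
    * intros u u' _ _ H' Hu Hu'; unfold h.
      eval_dec; auto; now apply (le_mulC HB).
  + intros Hl v r Hv; simpl; destruct Vz as [t Ht].
    apply (Hl r (v z) (v t)); [now apply (pat_below B HB v)|now apply Hv].
Qed.

(** * A product of two letters below a term *)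

Lemma conn_closed x u w : E u w -> conn x u -> conn x w.
Proof. intros H Hu; now apply conn_edge with u. Qed.

(** Fold onto the path a, b, c, d: y goes to d, its neighbours to c, the rest of the side of y to b,
    the rest of the side of x to a. As x is not next to y, it lands on a. The conditions on a, b, c
    concern the letters in these classes. *)
Lemma fold_path_end (B : algebra) (HB : model B) (R : nat -> Prop) x y
    (r a b c d : B) :
  (forall u w, E u w -> R u -> R w) -> R x -> R y ->
  ~ E x y -> ~ L y -> col0 x <> col0 y -> pat k r -> horn (M2 x y) B ->
  (forall u, R u -> L u -> col0 u = col0 x -> ~ E u y -> a ≼ r) ->
  (forall u, R u -> L u -> col0 u = col0 y -> b ≼ r) ->
  (forall u, R u -> L u -> E u y -> c ≼ r) ->
  a ⊙ b ≼ r -> b ⊙ c ≼ r -> c ⊙ d ≼ r -> a ⊙ d ≼ r.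
Proof.
intros HR Rx Ry Hxy Ly Hc Hr Hm Ha Hb Hc' Hab Hbc Hcd.
pose (h u := if Nat.eq_dec u y then d
             else if Bool.bool_dec (col0 u) (col0 y) then b
             else if dec (E u y) then c else a).
assert (H : h x ⊙ h y ≼ r).
{ apply (fold_region B HB r R h (M2 x y) (col0 y)); auto.
  - intros u Ru Lu; unfold h; eval_dec; eauto.
    apply (Ha u); auto; destruct (col0 u), (col0 x), (col0 y); congruence.
  - intros u w _ _ H Hu Hw; unfold h.
    eval_dec; try (apply (le_mulC HB); assumption); auto.
    subst u; match goal with n : ~ E w y |- _ => contradiction n; auto end. }
revert H; unfold h; eval_dec; auto.
Qed.

(** Here both ends are singled out: x goes to a and y to d, the other vertices of their sides to c
    and b. No letter lands on a or d. *)
Lemma fold_path (B : algebra) (HB : model B) (R : nat -> Prop) x y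
    (r a b c d : B) :
  (forall u w, E u w -> R u -> R w) -> R x -> R y ->
  ~ E x y -> ~ L x -> ~ L y -> col0 x <> col0 y -> pat k r ->
  horn (M2 x y) B ->
  (forall u, R u -> L u -> col0 u = col0 y -> b ≼ r) ->
  (forall u, R u -> L u -> col0 u = col0 x -> c ≼ r) ->
  a ⊙ b ≼ r -> b ⊙ c ≼ r -> c ⊙ d ≼ r -> a ⊙ d ≼ r.
Proof.
intros HR Rx Ry Hxy Lx Ly Hc Hr Hm Hb Hc' Hab Hbc Hcd.
pose (h u := if Nat.eq_dec u x then a else if Nat.eq_dec u y then d
             else if Bool.bool_dec (col0 u) (col0 x) then c else b).
assert (H : h x ⊙ h y ≼ r).
{ apply (fold_region B HB r R h (M2 x y) (col0 x)); auto.
  - intros u Ru Lu; unfold h; eval_dec; eauto.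
    apply (Hb u); auto; destruct (col0 u), (col0 x), (col0 y); congruence.
  - intros u w _ _ H Hu Hw; unfold h.
    eval_dec; try (apply (le_mulC HB); assumption); auto. }
revert H; unfold h; eval_dec; auto.
Qed.

Section Pair.

Variables x y : nat.
Hypotheses (Vx : vertex x) (Vy : vertex y) (Hxy : ~ E x y).
Hypothesis (Hcxy : col0 x <> col0 y).

Lemma ax_no_letter :
  conn x y -> (forall w, L w -> ~ conn x w) -> axiomatizable (horn (M2 x y)).
Proof.
intros Cxy HL; apply ax_iff with (delta_law k); [|apply ax_delta].
intros B HB; split.
- intros Hm r a b c d Hr.
  apply (fold_path B HB (conn x) x y); auto using conn_refl.
  + apply conn_closed.
  + intros Lx; now apply (HL x), conn_refl.
  + intros Ly; now apply (HL y).
  + intros u Cu Lu; now contradiction (HL u).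
  + intros u Cu Lu; now contradiction (HL u).
- intros Hl v r Hv; simpl.
  destruct (conn_odd col0 Hcol0 x y Cxy Hcxy) as (s & j & Hs & Hj).
  apply (even_walk_ind (fun u => v x ⊙ v u ≼ r) j s y); auto; [|now apply Hv].
  intros u w u' Hu H1 H2; apply (Hl r (v x) (v u) (v w)); auto;
    try now apply Hv.
  now apply (pat_below B HB v).
Qed.

(** ** Two-sided components *)

(* At each step of the walk [w] and [w'] exchange their roles. *)
Lemma kappa_walk (B : algebra) (HB : model B) (v : nat -> B) r n w w' u z :
  kappa_law B -> below v r ->
  v w ≼ r -> v w' ≼ r -> v w ⊙ v w' ≼ r -> v w ⊙ v u ≼ r -> walk n u z ->
  if Nat.odd n then v w' ⊙ v z ≼ r else v w ⊙ v z ≼ r.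
Proof.
intros Hl Hv; revert w w' u; induction n as [|n IH];
  intros w w' u Hw Hw' Hww' Hwu H.
- now apply walk_0 in H as <-.
- apply walk_S in H as (s & Hs & H).
  rewrite Nat.odd_succ, <- Nat.negb_odd.
  assert (H' : v w' ⊙ v s ≼ r).
  { apply (Hl r (v w') (v w) (v u)); auto; [now apply (le_mulC HB)|now apply Hv]. }
  specialize (IH w' w s Hw' Hw (le_mulC HB _ _ _ Hww') H' H).
  now destruct (Nat.odd n).
Qed.

Lemma kappa_full (B : algebra) (HB : model B) (v : nat -> B) r w w' z :
  kappa_law B -> below v r -> L w -> L w' -> conn w w' ->
  col0 w <> col0 w' -> conn w z -> col0 z <> col0 w -> v w ⊙ v z ≼ r.
Proof.
intros Hl Hv Lw Lw' Hc Hne Cz Hz.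
assert (Hww' : v w ⊙ v w' ≼ r) by now apply (below_opposite B HB).
destruct (conn_even col0 Hcol0 w' z) as [j Hj].
- apply conn_trans with w; auto using conn_sym.
- destruct (col0 w), (col0 w'), (col0 z); congruence.
- assert (H := kappa_walk B HB v r (2 * j) w w' w' z Hl Hv).
  rewrite Nat.odd_mul in H; apply H; auto; now apply Hv.
Qed.

Section TwoSided.

Hypothesis Cxy : conn x y.
Variables p q : nat.
Hypotheses (Lp : L p) (Lq : L q) (Cp : conn x p) (Cq : conn x q).
Hypotheses (Ep : col0 p = col0 x) (Eq : col0 q = col0 y).

Lemma kind_KD : k = KD.
Proof.
assert (H : two_sided x) by (apply (two_sided_intro col0 x p q); auto; congruence).
destruct k; simpl in Hk; auto.
- contradiction (Hk p Lp); apply conn_vertex with x; auto using conn_sym.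
- now contradiction (proj2 Hk x).
Qed.

Lemma pat_opposite (B : algebra) (r a b : B) :
  a ≼ r -> b ≼ r -> a ⊙ b ≼ r -> pat k r.
Proof. intros; rewrite kind_KD; exists a, b; auto. Qed.

Lemma kappa_of_horn (B : algebra) (HB : model B) :
  ~ L y -> (forall w, L w -> ~ E w y) -> horn (M2 x y) B -> kappa_law B.
Proof.
intros Ly Hy Hm r a b c d [Ha Hb] Hab Hbc Hcd.
apply (fold_path_end B HB (conn x) x y) with b c; auto using conn_refl.
- apply conn_closed.
- now apply (pat_opposite B r a b).
- intros u _ Lu H; now contradiction (Hy u).
Qed.

Lemma epsilon_of_horn (B : algebra) (HB : model B) :
  ~ L y -> horn (M2 x y) B -> epsilon_law B.
Proof.
intros Ly Hm r a b c d (Ha & Hb & Hc) Hab Hbc Hcd.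
apply (fold_path_end B HB (conn x) x y) with b c; auto using conn_refl.
- apply conn_closed.
- now apply (pat_opposite B r a b).
Qed.

Lemma mu2_of_horn (B : algebra) (HB : model B) :
  ~ L x -> ~ L y -> horn (M2 x y) B -> mu2_law B.
Proof.
intros Lx Ly Hm r a b c d [Hb Hc] Hab Hbc Hcd.
apply (fold_path B HB (conn x) x y) with b c; auto using conn_refl.
- apply conn_closed.
- now apply (pat_opposite B r b c).
Qed.

Lemma mu2_of_neighbors (B : algebra) (HB : model B) (v : nat -> B) r w w' :
  mu2_law B -> v w ≼ r -> v w' ≼ r -> v w ⊙ v w' ≼ r ->
  v w ⊙ v y ≼ r -> v w' ⊙ v x ≼ r -> v x ⊙ v y ≼ r.
Proof.
intros Hl Hw Hw' H Hy Hx.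
apply (Hl r (v x) (v w') (v w)); auto; now apply (le_mulC HB).
Qed.

Lemma ax_two_sided_letter :
  L x -> ~ L y -> axiomatizable (horn (M2 x y)).
Proof.
intros Lx Ly; destruct (classic (exists w, L w /\ E w y)) as [(w & Lw & Hw)|H].
- apply ax_iff with epsilon_law; [|apply ax_epsilon].
  intros B HB; split; [now apply epsilon_of_horn|].
  intros Hl v r Hv; simpl.
  assert (Ew : col0 w = col0 x).
  { rewrite (Hcol0 _ _ Hw) in Hcxy; destruct (col0 w), (col0 x); easy. }
  assert (Cw : conn x w).
  { apply conn_trans with y; auto; apply conn_edge with y; auto using conn_refl. }
  (* The path is x, q, w, y; its first two products exist because opposite letters of one component
     always multiply below [r]. *)
  apply (Hl r (v x) (v q) (v w)); [repeat apply conj| | |]; try now apply Hv.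
  + apply (below_opposite B HB); auto; congruence.
  + apply (below_opposite B HB); auto; [|congruence].
    apply conn_trans with x; auto using conn_sym.
- apply ax_iff with kappa_law; [|apply ax_kappa].
  intros B HB; split; [apply kappa_of_horn; eauto|].
  intros Hl v r Hv; apply (kappa_full B HB v r x q y); auto; congruence.
Qed.

End TwoSided.

(** ** One-sided components *)

(** The letter w stays at the end a of α while the other end advances two edges at a time. *)
Lemma alpha_connects (B : algebra) (HB : model B) (v : nat -> B) r w z :
  alpha_law k B -> below v r -> L w -> conn w z -> col0 w <> col0 z ->
  v w ⊙ v z ≼ r.
Proof.
intros Hl Hv Lw Cwz Hne.
destruct (conn_odd col0 Hcol0 w z Cwz Hne) as (s & j & Hs & Hj).
apply (even_walk_ind (fun u => v w ⊙ v u ≼ r) j s z); auto; [|now apply Hv].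
intros u s' u' Hu H1 H2; apply (Hl r (v w) (v u) (v s')); auto; try now apply Hv.
split; [now apply (pat_below B HB v)|now apply Hv].
Qed.

Lemma mu_step (B : algebra) (HB : model B) (v : nat -> B) r w s :
  mu_law k B -> below v r -> L w ->
  v w ⊙ v y ≼ r -> v w ⊙ v s ≼ r -> E s x -> v x ⊙ v y ≼ r.
Proof.
intros Hl Hv Lw Hy Hs Hx; apply (le_mulC HB), (Hl r (v y) (v w) (v s)); auto.
- split; [now apply (pat_below B HB v)|now apply Hv].
- now apply (le_mulC HB).
- now apply Hv.
Qed.

Lemma iota_connects (B : algebra) (HB : model B) (v : nat -> B) r w u :
  iota_law k B -> below v r -> L w -> v w ⊙ v y ≼ r -> v u ⊙ v y ≼ r ->
  conn u x -> col0 u = col0 x -> v x ⊙ v y ≼ r.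
Proof.
intros Hl Hv Lw Hwy Huy Cux Eux.
destruct (conn_even col0 Hcol0 u x Cux Eux) as [j Hj].
assert (Hyw := le_mulC HB _ _ _ Hwy).
apply (le_mulC HB).
apply (even_walk_ind (fun u => v y ⊙ v u ≼ r) j u x); auto;
  [|now apply (le_mulC HB)].
intros u' s' u'' Hu H1 H2.
(* The five edges run along y, w, y, u', s', u'': the detour from y to the letter w and back puts a
   letter in position 1. *)
apply (Hl r (v y) (v w) (v y) (v u') (v s')); auto; try now apply Hv.
now apply (pat_below B HB v).
Qed.

Section OneSided.

(** [R] is the component of x when x and y are connected, and the whole graph when they are not. *)
Variable R : nat -> Prop.
Hypothesis R_closed : forall u w, E u w -> R u -> R w.
Hypotheses (Rx : R x) (Ry : R y).
Hypothesis one_side : forall u, R u -> L u -> col0 u = col0 x.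

Lemma one_side_y : ~ L y.
Proof. intros Ly; apply Hcxy; symmetry; now apply one_side. Qed.

Lemma alpha_of_horn (B : algebra) (HB : model B) :
  (forall w, L w -> ~ E w y) -> horn (M2 x y) B -> alpha_law k B.
Proof.
intros Hy Hm r a b c d [Hr Ha]; apply (fold_path_end B HB R x y);
  auto using one_side_y.
- intros u Ru Lu Eu; exfalso; apply Hcxy; rewrite <- Eu; symmetry; auto.
- intros u _ Lu H; now contradiction (Hy u).
Qed.

(** In γ_1 both path vertices that receive the side of x are letters, so letters anywhere on that
    side are harmless. *)
Lemma gamma1_of_horn (B : algebra) (HB : model B) :
  horn (M2 x y) B -> gamma_law k 1 B.
Proof.
intros Hm r f z Hr H0 H2 Hf Hz.
apply (fold_path_end B HB R x y) with (f 1) (f 2); auto using one_side_y;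
  try (apply Hf; lia).
intros u Ru Lu Eu; exfalso; apply Hcxy; rewrite <- Eu; symmetry; auto.
Qed.

Lemma mu_of_horn (B : algebra) (HB : model B) :
  ~ L x -> horn (M2 x y) B -> mu_law k B.
Proof.
intros Lx Hm r a b c d [Hr Hb] Hab Hbc Hcd; apply (le_mulC HB).
(* The path is read backwards: x goes to d and the rest of its side, which holds all the letters, to
   b. *)
apply (fold_path B HB R x y) with c b; auto using one_side_y;
  try (apply (le_mulC HB); assumption).
intros u Ru Lu Eu; exfalso; apply Hcxy; rewrite <- Eu; symmetry; auto.
Qed.

(** Fold by distance from x: x, its neighbours and the vertices at distance two go to x5, x4, x3;
    the rest of the two sides goes to x1 and x2. With no letter at distance two, all letters land on
    x1, while y lands on x2. *)
Lemma fold_far (B : algebra) (HB : model B) (r x1 x2 x3 x4 x5 : B) :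
  ~ L x -> (forall w s, L w -> E x s -> ~ E s w) -> horn (M2 x y) B ->
  pat k r -> x1 ≼ r -> x1 ⊙ x2 ≼ r -> x2 ⊙ x3 ≼ r -> x3 ⊙ x4 ≼ r ->
  x4 ⊙ x5 ≼ r -> x2 ⊙ x5 ≼ r.
Proof.
intros Lx Hfar Hm Hr H1 H12 H23 H34 H45.
pose (h u := if Nat.eq_dec u x then x5
             else if Bool.bool_dec (col0 u) (col0 x)
             then if dec (exists s, E x s /\ E s u) then x3 else x1
             else if dec (E x u) then x4 else x2).
apply (le_mulC HB); assert (H : h x ⊙ h y ≼ r).
{ apply (fold_region B HB r R h (M2 x y) (col0 x)); auto.
  - intros u Ru Lu; unfold h.
    assert (Hu := one_side u Ru Lu).
    assert (Hux : u <> x) by (intros ->; auto).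
    eval_dec; auto; exfalso.
    match goal with e : exists s, _ |- _ => destruct e as (s & Hs & Hsu) end.
    now apply (Hfar u s).
  - intros u w Ru Rw H Hu Hw; unfold h.
    eval_dec; auto; try (apply (le_mulC HB); assumption); exfalso;
      try congruence.
    all: match goal with n : ~ exists s, _ |- _ => apply n; eauto end. }
revert H; unfold h; eval_dec; auto.
Qed.

Lemma iota_of_horn (B : algebra) (HB : model B) :
  ~ L x -> (forall w s, L w -> E x s -> ~ E s w) -> horn (M2 x y) B ->
  iota_law k B.
Proof.
intros Lx Hfar Hm r x0 x1 x2 x3 x4 x5 Hr H1 H01 H12 H23 H34 H45.
assert (H10 := le_mulC HB _ _ _ H01).
(* The missing product of x0 and x3 comes from a second fold, onto the walk x1, x0, x1, x2, x3. *)
apply (fold_far B HB r x1 x0 x3 x4 x5); auto.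
apply (fold_far B HB r x1 x0 x1 x2 x3); auto.
Qed.

End OneSided.

(** * Two variables in different components, both with letters *)

Section Split.

Hypothesis Cxy : ~ conn x y.
Hypothesis HK : k = KC.
Hypothesis (Ex : col0 x = true).
Variables p q : nat.
Hypotheses (Lp : L p) (Lq : L q) (Cp : conn x p) (Cq : conn y q).

Lemma all_one_side u : True -> L u -> col0 u = col0 x.
Proof. intros _ Lu; rewrite Ex; now apply Hfit. Qed.

(** The component of x folds onto C(a,b) and all the rest onto C(c,d). All letters are on the side
    of x, so x goes to a and y to d. *)
Lemma beta_of_horn (B : algebra) (HB : model B) :
  horn (M2 x y) B -> beta_law B.
Proof.
intros Hm r a b c d Ha Hab Hc Hcd.
pose (h u := if dec (conn x u)
             then if Bool.bool_dec (col0 u) (col0 x) then a else b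
             else if Bool.bool_dec (col0 u) (col0 x) then c else d).
assert (H : h x ⊙ h y ≼ r).
{ apply (fold_region B HB r (fun _ => True) h (M2 x y) (col0 x)); auto.
  - rewrite HK; exists a, b; auto.
  - intros u _ Lu; unfold h; assert (Hu := all_one_side u I Lu); eval_dec; auto.
  - intros u w _ _ H Hu Hw; unfold h; assert (Hc' := conn_edge_iff x u w H).
    eval_dec; auto; tauto. }
revert H; unfold h; assert (Cxx := conn_refl x); eval_dec; auto.
Qed.

Lemma beta_connects (B : algebra) (HB : model B) (v : nat -> B) r w w' s :
  beta_law B -> below v r -> L w -> L w' -> v w ⊙ v s ≼ r ->
  v w' ⊙ v y ≼ r -> v w ⊙ v y ≼ r.
Proof.
intros Hl Hv Lw Lw' Hs Hy.
apply (Hl r (v w) (v s) (v w') (v y)); auto; now apply Hv.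
Qed.

(** β moves the product with y between any two letters that have neighbours, which replaces the
    chains of the connected case: no γ_n occurs. What remains is to reach y (α) and to pass from a
    letter to x (μ or ι). *)
Lemma ax_split : axiomatizable (horn (M2 x y)).
Proof.
assert (Hkn : k <> KN) by congruence.
assert (closed : forall u w : nat, E u w -> True -> True) by auto.
assert (Hq : col0 q <> col0 y).
{ intros Hq; apply Hcxy; rewrite <- Hq; symmetry; now apply all_one_side. }
assert (Hp : col0 p = col0 x) by now apply all_one_side.
destruct (classic (exists w, L w /\ E w y)) as [(w & Lw & Hw)|Hny],
  (classic (L x)) as [Lx|Lx].
- apply ax_iff with beta_law; [|apply ax_beta].
  intros B HB; split; [now apply beta_of_horn|].
  intros Hl v r Hv; destruct Vx as [s Hs].
  apply (beta_connects B HB v r x w s); auto; now apply Hv.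
- destruct (classic (exists w' s, L w' /\ E x s /\ E s w')) as
    [(w' & s & Lw' & Hs & Hw')|Hfar].
  + apply ax_iff with (fun B => beta_law B /\ mu_law k B).
    2:{ apply ax_and; [apply ax_beta|now apply ax_mu]. }
    intros B HB; split.
    { intros Hm; split; [now apply beta_of_horn|].
      apply (mu_of_horn (fun _ => True)); auto using all_one_side. }
    intros [Hl Hl'] v r Hv.
    assert (Hs' : v w' ⊙ v s ≼ r) by (apply Hv; auto).
    apply (mu_step B HB v r w' s); auto.
    apply (beta_connects B HB v r w' w s); auto; now apply Hv.
  + apply ax_iff with (fun B => beta_law B /\ iota_law k B).
    2:{ apply ax_and; [apply ax_beta|now apply ax_iota]. }
    intros B HB; split.
    { intros Hm; split; [now apply beta_of_horn|].
      apply (iota_of_horn (fun _ => True)); auto using all_one_side.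
      intros w' s Lw' Hs Hw'; apply Hfar; eauto. }
    intros [Hl Hl'] v r Hv; simpl.
    destruct (conn_vertex p x) as [s Hs]; auto using conn_sym.
    assert (Hpy : v p ⊙ v y ≼ r).
    { apply (beta_connects B HB v r p w s); auto; now apply Hv. }
    apply (iota_connects B HB v r p p); auto using conn_sym.
- apply ax_iff with (fun B => beta_law B /\ alpha_law k B).
  2:{ apply ax_and; [apply ax_beta|now apply ax_alpha]. }
  intros B HB; split.
  { intros Hm; split; [now apply beta_of_horn|].
    apply (alpha_of_horn (fun _ => True)); eauto using all_one_side. }
  intros [Hl Hl'] v r Hv; destruct Vx as [s Hs].
  apply (beta_connects B HB v r x q s); auto; [now apply Hv|].
  apply (alpha_connects B HB); auto using conn_sym.
- apply ax_iff with (fun B => beta_law B /\ alpha_law k B /\ mu_law k B).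
  2:{ repeat apply ax_and; [apply ax_beta|now apply ax_alpha|now apply ax_mu]. }
  intros B HB; split.
  { intros Hm; split; [now apply beta_of_horn|split].
    - apply (alpha_of_horn (fun _ => True)); eauto using all_one_side.
    - apply (mu_of_horn (fun _ => True)); auto using all_one_side. }
  intros (Hl & Hl' & Hl'') v r Hv; destruct Vx as [s Hs].
  assert (Hps : v p ⊙ v s ≼ r).
  { apply (alpha_connects B HB); auto.
    - apply conn_edge with x; auto using conn_sym.
    - rewrite (Hcol0 _ _ Hs), Hp; now destruct (col0 x). }
  apply (mu_step B HB v r p s); auto.
  apply (beta_connects B HB v r p q s); auto.
  apply (alpha_connects B HB); auto using conn_sym.
Qed.

End Split.

Lemma least_nat (P : nat -> Prop) :
  (exists n, P n) -> exists n, P n /\ forall m, m < n -> ~ P m.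
Proof.
intros [n Hn]; induction n as [n IH] using lt_wf_ind.
destruct (classic (exists m, m < n /\ P m)) as [(m & Hm & HP)|H]; [eauto|].
exists n; split; [exact Hn|]; intros m Hm HP; eauto.
Qed.

(** * Connected pairs with letters on one side only, one of them next to y *)

Section Chains.

Hypothesis Cxy : conn x y.
Hypothesis one_side : forall u, conn x u -> L u -> col0 u = col0 x.
Hypothesis near_y : exists w, L w /\ E w y.

Section Levels.

(** [M] is the near side of the cut. It is kept abstract because it will be a set of reached
    letters, once with a non-letter x added. *)
Variables (M : nat -> Prop) (n : nat).
Hypothesis n_pos : 1 <= n.
Hypothesis M_side : forall w, M w -> conn x w /\ col0 w = col0 x.
Hypothesis M_sep :
  forall w w', M w -> L w' -> walk (2 * (n - 1)) w w' -> M w'.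
Hypothesis M_y : forall w, M w -> ~ E w y.

Definition reached (i u : nat) : Prop := exists w, M w /\ walk i w u.

(* The distance to [M], folded at [2 * n]. *)
Definition level (u j : nat) : Prop :=
  (j < 2 * n /\ reached j u /\ forall i, i < j -> ~ reached i u) \/
  ((forall i, i < 2 * n -> ~ reached i u) /\
   j = if Bool.bool_dec (col0 u) (col0 x) then 2 * n else 2 * n - 1).

Lemma level_exists u : exists j, level u j.
Proof.
destruct (classic (exists j, j < 2 * n /\ reached j u)) as [H|H].
- destruct (least_nat _ H) as (j & [Hj Hr] & Hmin).
  exists j; left; repeat split; auto.
  intros i Hi Hr'; apply (Hmin i Hi); split; [lia|exact Hr'].
- eexists; right; split; [|reflexivity]; intros i Hi Hr; eauto.
Qed.

Lemma reached_even i u : reached i u -> col0 u = col0 x -> exists j, i = 2 * j.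
Proof.
intros (w & Mw & Hw) Hu; destruct (M_side w Mw) as [_ Ew].
rewrite (walk_col col0 Hcol0 i w u Hw), Ew in Hu.
destruct (Nat.Even_or_Odd i) as [[j ->]|Ho]; [eauto|].
apply Nat.odd_spec in Ho; rewrite Ho in Hu; now destruct (col0 x).
Qed.

Lemma reached_step i u w : reached i u -> E u w -> reached (S i) w.
Proof.
intros (s & Ms & Hs) H; exists s; split; [exact Ms|].
now apply walk_rcons with u.
Qed.

Lemma reached_letter j u : reached (2 * j) u -> j < n -> L u -> M u.
Proof.
intros (w & Mw & Hw) Hj Lu; apply (M_sep w); auto.
replace (2 * (n - 1)) with (2 * j + 2 * (n - 1 - j)) by lia.
apply walk_pad; auto.
apply conn_vertex with x; auto; apply conn_sym; now apply M_side.
Qed.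

(** On the side of x the distances to [M] are even, so along an edge they differ by exactly one;
    beyond the fold the values alternate between 2n and 2n - 1. *)
Lemma level_edge u w i j :
  E u w -> col0 u = col0 x -> col0 w <> col0 x -> level u i -> level w j ->
  i <= 2 * n /\ j <= 2 * n /\ (j = S i \/ i = S j).
Proof.
intros H Hu Hw [(Hi & Ri & Mi)|[Ni Hi]] [(Hj & Rj & Mj)|[Nj Hj]].
- assert (R1 := reached_step i u w Ri H).
  assert (R2 := reached_step j w u Rj (E_sym _ _ H)).
  destruct (reached_even i u Ri Hu) as [i' ->].
  destruct (reached_even _ u R2 Hu) as [j' Hj'].
  assert (~ S (2 * i') < j) by (intros H'; now apply (Mj _ H')).
  assert (~ S j < 2 * i') by (intros H'; now apply (Mi _ H')).
  lia.
- exfalso; destruct (reached_even i u Ri Hu) as [i' ->].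
  apply (Nj (S (2 * i'))); [lia|now apply reached_step with u].
- destruct Bool.bool_dec in Hi; [|contradiction].
  assert (~ S j < 2 * n).
  { intros H'; apply (Ni _ H'), (reached_step j w); auto. }
  lia.
- destruct Bool.bool_dec in Hi; [|contradiction].
  destruct Bool.bool_dec in Hj; [contradiction|lia].
Qed.

(** A letter at distance less than 2n is, by parity and padding, at the end of a walk of length 2(n
    - 1) from [M], hence in [M] by [M_sep]. *)
Lemma level_letter u j : conn x u -> L u -> level u j -> j = 0 \/ j = 2 * n.
Proof.
intros Cu Lu [(Hj & Rj & Mj)|[_ ->]].
- left; destruct (reached_even j u Rj (one_side u Cu Lu)) as [j' ->].
  destruct j' as [|j']; auto; exfalso; apply (Mj 0); [lia|].
  exists u; split; [|apply walk_nil]; apply (reached_letter (S j')); auto; lia.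
- right; destruct Bool.bool_dec; auto; contradiction n0; auto.
Qed.

(** If y were closer, the letter next to it would be within 2(n - 1) of [M], hence in [M], against
    [M_y]. *)
Lemma level_y j : level y j -> j = 2 * n - 1.
Proof.
intros [(Hj & Rj & Mj)|[_ ->]].
- destruct near_y as (w & Lw & Hw).
  assert (Rw := reached_step j y w Rj (E_sym _ _ Hw)).
  destruct (reached_even _ w Rw) as [i Hi].
  { apply one_side; auto; apply conn_edge with y; auto. }
  assert (~ i < n); [|lia].
  intros H; rewrite Hi in Rw.
  now apply (M_y w (reached_letter i w Rw H Lw)).
- destruct Bool.bool_dec; auto; congruence.
Qed.

Lemma fold_levels (B : algebra) (HB : model B) (r : B) (f : nat -> B) i :
  horn (M2 x y) B -> pat k r -> f 0 ≼ r -> f (2 * n) ≼ r ->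
  (forall j, j < 2 * n -> f j ⊙ f (S j) ≼ r) -> level x i ->
  f i ⊙ f (2 * n - 1) ≼ r.
Proof.
intros Hm Hr H0 H2n Hf Hi.
(* Levels are chosen, with the choice at x pinned to [i]; uniqueness of levels never has to be
   proved. *)
assert (Hl : forall u, {j | level u j /\ (u = x -> j = i)}).
{ intros u; apply constructive_indefinite_description.
  destruct (Nat.eq_dec u x) as [Hu|Hu].
  { exists i; rewrite Hu; auto. }
  destruct (level_exists u) as [j Hj]; exists j; split; [exact Hj|easy]. }
pose (h u := f (proj1_sig (Hl u))).
assert (H : h x ⊙ h y ≼ r).
{ apply (fold_region B HB r (conn x) h (M2 x y) (col0 x)); auto using conn_refl.
  - apply conn_closed.
  - intros u Cu Lu; unfold h; destruct (Hl u) as [j [Hj Hj']]; simpl.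
    destruct (level_letter u j Cu Lu Hj) as [Ej|Ej]; now rewrite Ej.
  - intros u w Cu Cw H Hu Hw; unfold h.
    destruct (Hl u) as [a [Ha Ha0]], (Hl w) as [b [Hb Hb0]]; simpl.
    destruct (level_edge u w a b H Hu Hw Ha Hb) as (Ha' & Hb' & [-> | ->]).
    + apply Hf; lia.
    + apply (le_mulC HB), Hf; lia. }
revert H; unfold h; destruct (Hl x) as [a [Ha' Ha]], (Hl y) as [b [Hb Hb']]; simpl.
now rewrite (Ha eq_refl), (level_y b Hb).
Qed.

End Levels.

Section Reach.

(** The chain starts at x itself if x is a letter, and otherwise at the letters at distance two from
    x. *)
Variable start : nat -> Prop.
Hypothesis start_L : forall u, start u -> L u /\ conn x u.
Hypothesis start_inhabited : exists u, start u.

Inductive reach (n : nat) : nat -> Prop :=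
| reach_start w : start w -> reach n w
| reach_jump w w' : reach n w -> L w' -> walk (2 * n) w w' -> reach n w'.

Lemma reach_side n w : reach n w -> L w /\ conn x w.
Proof.
induction 1 as [w Hw|w w' _ IH Lw' H]; [auto|].
split; [exact Lw'|]; apply conn_trans with w; [apply IH|now exists (2 * n)].
Qed.

Definition hits (n : nat) : Prop := exists w, reach n w /\ E w y.

Lemma hits_exists : exists n, 1 <= n /\ hits n.
Proof.
destruct start_inhabited as [u Hu], near_y as (w & Lw & Hw).
destruct (start_L u Hu) as [Lu Cu].
assert (Cw : conn x w) by (apply conn_edge with y; auto).
destruct (conn_even col0 Hcol0 u w) as [j Hj].
- apply conn_trans with x; auto using conn_sym.
- rewrite (one_side u), (one_side w); auto.
- exists (S j); split; [lia|]; exists w; split; [|exact Hw].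
  apply reach_jump with u; [now apply reach_start|exact Lw|].
  replace (2 * S j) with (2 * j + 2 * 1) by lia; apply walk_pad; auto.
  apply conn_vertex with x; auto using conn_sym.
Qed.

(** The chain is run backwards: γ_n carries the product with y from the end of each jump to its
    beginning. *)
Lemma gamma_reach (B : algebra) (HB : model B) (v : nat -> B) r n w :
  gamma_law k n B -> below v r -> reach n w -> E w y ->
  exists u, start u /\ v u ⊙ v y ≼ r.
Proof.
intros Hl Hv Hw Hwy.
assert (H : v w ⊙ v y ≼ r) by now apply Hv.
clear Hwy; revert H; induction Hw as [u Hu|u w' Hw IH Lw' Hww']; intros H;
  [eauto|].
apply IH; destruct (walk_seq _ _ _ Hww') as (f & <- & <- & Hf).
apply (Hl r (fun j => v (f j))); auto.
- now apply (pat_below B HB v).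
- apply Hv; now apply (reach_side n).
- now apply Hv.
- intros j Hj; apply Hv; auto.
Qed.

Lemma least_hits :
  exists n, 1 <= n /\ hits n /\ (n = 1 \/ 2 <= n /\ ~ hits (n - 1)).
Proof.
destruct (least_nat _ hits_exists) as (n & [Hn Hh] & Hmin).
exists n; repeat split; auto.
destruct (Nat.eq_dec n 1) as [|H]; [now left|right; split; [lia|]].
intros H'; apply (Hmin (n - 1)); [lia|split; [lia|exact H']].
Qed.

Lemma fold_reach (B : algebra) (HB : model B) n (r : B) (f : nat -> B) i :
  1 <= n -> ~ hits (n - 1) -> horn (M2 x y) B -> pat k r ->
  f 0 ≼ r -> f (2 * n) ≼ r ->
  (forall j, j < 2 * n -> f j ⊙ f (S j) ≼ r) -> level (reach (n - 1)) n x i ->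
  f i ⊙ f (2 * n - 1) ≼ r.
Proof.
intros Hn Hh; apply fold_levels; auto.
- intros w Hw; destruct (reach_side _ _ Hw); auto.
- intros w w' Hw Lw' H; now apply reach_jump with w.
- intros w Hw H; apply Hh; now exists w.
Qed.

End Reach.

(* The edge from [f 0] to [f (2n - 1)] leaves a path of length [2] between the
   two letters, to which [gamma_1] applies. *)
Lemma gamma_of_edge (B : algebra) (HB : model B) n :
  1 <= n -> gamma_law k 1 B ->
  (forall (r : B) (f : nat -> B) z, pat k r -> f 0 ≼ r -> f (2 * n) ≼ r ->
     (forall j, j < 2 * n -> f j ⊙ f (S j) ≼ r) -> f (2 * n) ⊙ z ≼ r ->
     f 0 ⊙ f (2 * n - 1) ≼ r) ->
  gamma_law k n B.
Proof.
intros Hn H1 H r f z Hr H0 H2n Hf Hz.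
apply (H1 r (fun j => match j with
                      | 0 => f 0 | 1 => f (2 * n - 1) | _ => f (2 * n) end));
  auto.
intros [|[|j]] Hj; [apply (H r f z); auto| |lia].
specialize (Hf (2 * n - 1)).
replace (S (2 * n - 1)) with (2 * n) in Hf by lia; apply Hf; lia.
Qed.

Hypothesis not_KN : k <> KN.

Lemma ax_chain_letter : L x -> axiomatizable (horn (M2 x y)).
Proof.
intros Lx.
assert (Hs : forall u, u = x -> L u /\ conn x u)
  by (intros u ->; auto using conn_refl).
destruct (least_hits (fun u => u = x) Hs) as (n & Hn & (w & Hw & Hwy) & Hmin);
  [now exists x|].
apply ax_iff with (gamma_law k n); [|now apply ax_gamma].
intros B HB; split.
- intros Hm.
  assert (G1 : gamma_law k 1 B)
    by (apply (gamma1_of_horn (conn x)); auto using conn_refl;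
        apply conn_closed).
  destruct Hmin as [-> | [Hn2 Hh]]; [exact G1|].
  apply gamma_of_edge; auto.
  intros r f z Hr H0 H2n Hf Hz.
  apply (fold_reach (fun u => u = x) Hs); auto.
  left; repeat split; [lia| |lia].
  exists x; split; [now apply reach_start|apply walk_nil].
- intros Hl v r Hv.
  now destruct (gamma_reach _ Hs B HB v r n w Hl Hv Hw Hwy) as (u & -> & H).
Qed.

Lemma ax_chain_no_letter :
  ~ L x -> (exists w s, L w /\ E x s /\ E s w) ->
  axiomatizable (horn (M2 x y)).
Proof.
intros Lx Hnear.
pose (start u := L u /\ exists s, E x s /\ E s u).
assert (Hs : forall u, start u -> L u /\ conn x u).
{ intros u [Lu (s & H1 & H2)]; split; [exact Lu|].
  exists 2; now apply walk2 with s. }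
destruct (least_hits start Hs) as (n & Hn & (w & Hw & Hwy) & Hmin).
{ destruct Hnear as (w & s & Lw & H); exists w; split; eauto. }
apply ax_iff with (fun B => gamma_law k n B /\ mu_law k B);
  [|now apply ax_and; [apply ax_gamma|apply ax_mu]].
intros B HB; split.
- intros Hm; split; cycle 1.
  { apply (mu_of_horn (conn x)); auto using conn_refl; apply conn_closed. }
  assert (G1 : gamma_law k 1 B)
    by (apply (gamma1_of_horn (conn x)); auto using conn_refl;
        apply conn_closed).
  destruct Hmin as [-> | [Hn2 Hh]]; [exact G1|].
  (* When [2 < n], [x] may be too close to the remaining letters to be sent
     to [f 0]; it goes to [f 2], and [gamma_2] transfers the product to [f 0]. *)
  assert (G2 : gamma_law k 2 B).
  { apply gamma_of_edge; auto.
    intros r f z Hr H0 H4 Hf Hz.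
    (* Adding x to the near side puts it at level 0. The set is closed under jumps of length 2: from
       x they end in [start], and from a reached letter they pad to length 2(n - 1). *)
    apply (fold_levels (fun u => reach start (n - 1) u \/ u = x) 2); auto.
    - intros u [Hu|Hu]; [|subst u; auto using conn_refl].
      destruct (reach_side _ Hs _ _ Hu); auto.
    - intros u u' Hu Lu' H; left; simpl in H.
      destruct Hu as [Hu| ->].
      + apply reach_jump with u; auto.
        replace (2 * (n - 1)) with (2 + 2 * (n - 2)) by lia.
        apply walk_pad; auto; apply conn_vertex with x; auto.
        apply conn_sym; now apply (reach_side _ Hs (n - 1)).
      + apply reach_start; split; [exact Lu'|now apply walk2_inv].
    - intros u [Hu| ->] H; [apply Hh; now exists u|contradiction].
    - left; repeat split; [lia| |lia].
      exists x; split; [now right|apply walk_nil]. }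
  destruct (Nat.eq_dec n 2) as [-> |Hn3]; [exact G2|].
  intros r f z Hr H0 H2n Hf Hz.
  (* The level of x is exactly 2: not 0, since x is not a letter, and not 1, by colour. *)
  assert (H2 : f 2 ⊙ f (2 * n - 1) ≼ r).
  { apply (fold_reach start Hs); auto.
    destruct Hnear as (u & s & Lu & H1 & H2).
    left; repeat split; [lia| |].
    - exists u; split; [apply reach_start; split; eauto|].
      apply walk2 with s; auto.
    - intros [|[|i]] Hi (u' & Hu' & Hwalk); [| |lia];
        destruct (reach_side _ Hs _ _ Hu') as [Lu' Cu'].
      + now apply walk_0 in Hwalk as ->.
      + apply walk_S in Hwalk as (u'' & Hu'' & Hw'').
        apply walk_0 in Hw'' as ->.
        assert (Hc := Hcol0 _ _ Hu''); rewrite (one_side u') in Hc; auto.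
        now destruct (col0 x). }
  (* The new product shortens the path to f 0, f 1, f 2, f (2n - 1), f (2n), which has the length
     required by γ_2. *)
  apply (G2 r (fun j => match j with
    | 0 => f 0 | 1 => f 1 | 2 => f 2 | 3 => f (2 * n - 1) | _ => f (2 * n)
    end)); auto.
  intros [|[|[|[|j]]]] Hj; try lia; auto; [apply Hf; lia|apply Hf; lia|].
  specialize (Hf (2 * n - 1)).
  replace (S (2 * n - 1)) with (2 * n) in Hf by lia; apply Hf; lia.
- intros [Hl Hl'] v r Hv.
  destruct (gamma_reach _ Hs B HB v r n w Hl Hv Hw Hwy)
    as (u & [Lu (s & H1 & H2)] & H).
  apply (mu_step B HB v r u s); auto; now apply Hv, E_sym.
Qed.

End Chains.

(** Without a letter next to y, α provides the product of a letter with y. If x is not a letter, μ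
    makes the last step to x; ι replaces it when a letter is next to y but none is at distance two
    from x. *)
Lemma ax_one_sided :
  conn x y -> (forall u, conn x u -> L u -> col0 u = col0 x) ->
  (exists w, L w /\ conn x w) -> axiomatizable (horn (M2 x y)).
Proof.
intros Cxy Hside (p & Lp & Cp).
assert (Hkn : k <> KN).
{ intros ->; apply (Hk p Lp), conn_vertex with x; auto using conn_sym. }
destruct (classic (exists w, L w /\ E w y)) as [(w & Lw & Hw)|Hny],
  (classic (L x)) as [Lx|Lx].
- apply ax_chain_letter; eauto.
- destruct (classic (exists w' s, L w' /\ E x s /\ E s w')) as [Hnear|Hfar].
  + apply ax_chain_no_letter; eauto.
  + apply ax_iff with (iota_law k); [|now apply ax_iota].
    intros B HB; split.
    { apply (iota_of_horn (conn x)); auto using conn_refl; [apply conn_closed|].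
      intros w' s Lw' Hs Hw'; apply Hfar; eauto. }
    intros Hl v r Hv; simpl.
    assert (Cw : conn x w) by (apply conn_edge with y; auto).
    apply (iota_connects B HB v r w w); auto using conn_sym; now apply Hv.
- apply ax_iff with (alpha_law k); [|now apply ax_alpha].
  intros B HB; split.
  { apply (alpha_of_horn (conn x)); eauto using conn_refl; apply conn_closed. }
  intros Hl v r Hv; now apply (alpha_connects B HB).
- apply ax_iff with (fun B => alpha_law k B /\ mu_law k B).
  2:{ now apply ax_and; [apply ax_alpha|apply ax_mu]. }
  intros B HB; split.
  { intros Hm; split.
    - apply (alpha_of_horn (conn x)); eauto using conn_refl; apply conn_closed.
    - apply (mu_of_horn (conn x)); auto using conn_refl; apply conn_closed. }
  intros [Hl Hl'] v r Hv; destruct Vx as [s Hs].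
  assert (Ep := Hside p Cp Lp).
  apply (mu_step B HB v r p s); auto; apply (alpha_connects B HB); auto.
  + apply conn_trans with x; auto using conn_sym.
  + congruence.
  + apply conn_edge with x; auto using conn_sym.
  + rewrite (Hcol0 _ _ Hs), Ep; now destruct (col0 x).
Qed.

End Pair.

(** * Two-sided pairs, with x and y in either role *)

Section TwoSidedPair.

Variables x y p q : nat.
Hypotheses (Hxy : ~ E x y) (Hcxy : col0 x <> col0 y) (Cxy : conn x y).
Hypotheses (Lp : L p) (Lq : L q) (Cp : conn x p) (Cq : conn x q).
Hypotheses (Ep : col0 p = col0 x) (Eq : col0 q = col0 y).
Hypotheses (Vx : vertex x) (Vy : vertex y).

Let Hyx : ~ E y x.
Proof. auto. Qed.

Let Cyp : conn y p.
Proof. apply conn_trans with x; auto using conn_sym. Qed.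

Let Cyq : conn y q.
Proof. apply conn_trans with x; auto using conn_sym. Qed.

(** If x and y both have letters as neighbours, μ_2 closes the path x, w', w, y. Otherwise κ makes
    the opposite letters q and p act as such neighbours. *)
Lemma ax_two_sided_no_letter :
  ~ L x -> ~ L y -> axiomatizable (horn (M2 x y)).
Proof.
intros Lx Ly.
destruct (classic ((exists w, L w /\ E w y) /\ exists w, L w /\ E w x))
  as [[(w & Lw & Hw) (w' & Lw' & Hw')]|Hn].
- apply ax_iff with mu2_law; [|apply ax_mu2].
  intros B HB; split; [apply (mu2_of_horn x y) with p q; auto|].
  intros Hl v r Hv.
  apply (mu2_of_neighbors x y B HB v r w w'); auto; try now apply Hv.
  apply (below_opposite B HB); auto.
  + apply conn_trans with x; [|apply conn_edge with x; auto using conn_refl].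
    apply conn_sym, conn_edge with y; auto.
  + rewrite (Hcol0 _ _ Hw), (Hcol0 _ _ Hw') in Hcxy.
    destruct (col0 w), (col0 w'); easy.
- apply ax_iff with (fun B => mu2_law B /\ kappa_law B).
  2:{ apply ax_and; [apply ax_mu2|apply ax_kappa]. }
  intros B HB; split.
  + intros Hm; split; [apply (mu2_of_horn x y) with p q; auto|].
    apply not_and_or in Hn as [Hn|Hn].
    * apply (kappa_of_horn x y) with p q; auto; intros w Lw Hw; eauto.
    * apply (kappa_of_horn y x) with q p; auto using conn_sym, horn_sym.
      intros w Lw Hw; eauto.
  + intros [Hl Hl'] v r Hv; assert (Hne : col0 p <> col0 q) by congruence.
    assert (Cpq : conn p q) by (apply conn_trans with x; auto using conn_sym).
    apply (mu2_of_neighbors x y B HB v r p q); auto; try now apply Hv.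
    * now apply (below_opposite B HB).
    * apply (kappa_full B HB v r p q); auto using conn_sym; congruence.
    * apply (kappa_full B HB v r q p); auto using conn_sym; congruence.
Qed.

Lemma ax_two_sided : axiomatizable (horn (M2 x y)).
Proof.
destruct (classic (L x)) as [Lx|Lx], (classic (L y)) as [Ly|Ly].
- apply ax_true; intros B HB v r Hv; now apply (below_opposite B HB).
- apply (ax_two_sided_letter x y) with p q; auto.
- apply ax_sym, (ax_two_sided_letter y x) with q p; auto using conn_sym.
- now apply ax_two_sided_no_letter.
Qed.

End TwoSidedPair.

Lemma ax_connected x y :
  vertex x -> vertex y -> ~ E x y -> col0 x <> col0 y -> conn x y ->
  axiomatizable (horn (M2 x y)).
Proof.
intros Vx Vy Hxy Hne Cxy.
assert (Hcol : forall u, col0 u = col0 x \/ col0 u = col0 y)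
  by (intros u; destruct (col0 u), (col0 x), (col0 y); tauto).
destruct (classic (exists p, L p /\ conn x p /\ col0 p = col0 x))
  as [(p & Lp & Cp & Ep)|Hx],
  (classic (exists q, L q /\ conn x q /\ col0 q = col0 y))
  as [(q & Lq & Cq & Eq)|Hy].
- now apply (ax_two_sided x y p q).
- apply ax_one_sided; eauto.
  intros u Cu Lu; destruct (Hcol u); auto; exfalso; eauto.
- assert (Cyx := conn_sym x y Cxy).
  apply ax_sym, ax_one_sided; auto.
  + intros u Cu Lu; destruct (Hcol u); auto; exfalso.
    apply Hx; exists u; eauto using conn_trans.
  + exists q; split; [exact Lq|now apply conn_trans with x].
- apply ax_no_letter; auto.
  intros w Lw Cw; destruct (Hcol w); eauto.
Qed.

(** Recolouring the component of x keeps the colouring fitting, and then x and y have the same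
    colour. *)
Lemma ax_flip x y :
  vertex x -> vertex y -> col0 x <> col0 y -> ~ conn x y ->
  (k = KC -> forall w, L w -> ~ conn x w) -> axiomatizable (horn (M2 x y)).
Proof.
intros Vx Vy Hne Cxy HL.
apply (ax_same_color (fun u => if dec (conn x u) then negb (col0 u) else col0 u));
  auto.
- split.
  + apply (flip_bip col0 Hcol0 (conn x)); intros u w; apply conn_edge_iff.
  + intros HK u Lu; destruct dec as [Cu|]; [now contradiction (HL HK u)|].
    now apply Hfit.
- assert (Cxx := conn_refl x); eval_dec.
  destruct (col0 x), (col0 y); easy.
Qed.

Lemma ax_M2 x y : axiomatizable (horn (M2 x y)).
Proof.
destruct (classic (vertex x)) as [Vx|Vx]; [|now apply ax_not_vertex].
destruct (classic (vertex y)) as [Vy|Vy]; [|now apply ax_sym, ax_not_vertex].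
destruct (classic (E x y)) as [Hxy|Hxy].
{ apply ax_true; intros B HB v r Hv; now apply Hv. }
destruct (Bool.bool_dec (col0 x) (col0 y)) as [He|Hne].
{ now apply ax_same_color with col0. }
destruct (classic (conn x y)) as [Cxy|Cxy]; [now apply ax_connected|].
assert (Cyx : ~ conn y x) by (intros H; now apply Cxy, conn_sym).
destruct (classic (k = KC)) as [HK|HK]; [|now apply ax_flip].
destruct (classic (exists w, L w /\ conn x w)) as [(p & Lp & Cp)|Hx].
2:{ apply ax_flip; auto; intros _ w Lw Cw; eauto. }
destruct (classic (exists w, L w /\ conn y w)) as [(q & Lq & Cq)|Hy].
2:{ apply ax_sym, ax_flip; auto; intros _ w Lw Cw; eauto. }
(* All letters have colour true, so the variable of that colour takes the role of x in
   [ax_split]. *)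
destruct (col0 x) eqn:Ex.
- apply (ax_split x y) with p q; auto; congruence.
- apply ax_sym, (ax_split y x) with q p; auto; try congruence.
  destruct (col0 y); congruence.
Qed.

Lemma ax_horn m : axiomatizable (horn m).
Proof. destruct m; [apply ax_M0|apply ax_M1|apply ax_M2]. Qed.

End Graph.

(** * Inequalities between terms *)

Section Inequality.

Variable s : term.

Local Notation L := (letter s).
Local Notation E := (edge s).

Definition entails (m : mon) (B : algebra) : Prop :=
  forall (v : nat -> B) r, (forall n, In n (mons s) -> mle v n r) -> mle v m r.

Lemma ax_degenerate (s1 : term) :
  ~ (~ In M0 (mons s) /\ exists col, bip E col) ->
  axiomatizable (fun B => satisfies B (s1 ⪯ s)).
Proof.
intros H; apply ax_true; intros B HB; apply HB, satisfies_R12_le.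
intros v Hv; exfalso; apply H; split.
- intros H0.
  assert (T := proj1 (eval_le R12 model_R12 v _ s) (le_refl model_R12 _) _ H0).
  specialize (T r0); revert T Hv; destruct (eval R12 v s); easy.
- exists (fun x => r12_col (v x)); intros x y; now apply edge_r12_col.
Qed.

(** For a sum of variables the constant valuation b lies below b, so a monomial absent from s may be
    given a value that forces every a below every b. *)
Lemma ax_no_edge (m : mon) :
  (forall n, In n (mons s) -> exists x, n = M1 x) ->
  axiomatizable (entails m).
Proof.
intros Hs; destruct (classic (exists x, L x /\ m = M1 x)) as [(x & Hx & ->)|Hm].
{ apply ax_true; intros B HB v r Hr; now apply Hr in Hx. }
apply ax_iff with trivial_law; [|apply ax_trivial].
intros B HB; split.
- intros H.
  assert (Hc : forall (v : nat -> B) r, (forall x, L x -> v x ≼ r) -> mle v m r).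
  { intros v r Hv; apply H; intros n Hn.
    destruct (Hs n Hn) as [x ->]; now apply Hv. }
  assert (Hle : forall a b : B, a ≼ b).
  { intros a b; destruct m as [|z|x y].
    - apply (Hc (fun _ => b) b); intros x _; apply (le_refl HB).
    - specialize (Hc (fun x => if Nat.eq_dec x z then a else b) b); simpl in Hc.
      destruct (Nat.eq_dec z z); [|easy]; apply Hc; intros x Hx.
      destruct Nat.eq_dec as [->|]; [exfalso; eauto|apply (le_refl HB)].
    - apply (sqr_le HB b), (Hc (fun _ => b) b); intros z _; apply (le_refl HB). }
  intros a b; now apply (le_antisym HB).
- intros H v r _.
  assert (T : top r) by (intros a; rewrite (H a r); apply (le_refl HB)).
  destruct m; simpl; auto.
Qed.

(* In [R12] a term with an edge takes the value [c] when it is not [0]; then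
   the letters along a walk alternate between [a, p] and [b, q], and those
   below [c] are not [p]. *)
Lemma letters_odd_walk (x y n : nat) :
  L x -> L y -> walk E n x y -> Nat.odd n = true ->
  satisfies R12 (Var x * Var y ⪯ s).
Proof.
intros Lx Ly Hw Ho; apply satisfies_R12_le; intros v Hv.
assert (Hcol : bip E (fun x => r12_col (v x)))
  by (intros u w; now apply edge_r12_col).
assert (Hx := proj1 (eval_le R12 model_R12 v _ s) (le_refl model_R12 _) _ Lx).
assert (Hy := proj1 (eval_le R12 model_R12 v _ s) (le_refl model_R12 _) _ Ly).
assert (Hc := walk_col E _ Hcol n x y Hw); rewrite Ho in Hc.
assert (Hex : exists u, E x u).
{ destruct Hw as [|n x u y Hu _]; [easy|eauto]. }
assert (Hey : exists u, E y u).
{ apply walk_rev in Hw; [|apply edge_sym].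
  destruct Hw as [|n y u x Hu _]; [easy|eauto]. }
destruct Hex as [u Hu], Hey as [w Hw'].
destruct (edge_r12 s v x u Hv Hu) as [Hxu Hs].
destruct (edge_r12 s v y w Hv Hw') as [Hyw _].
revert Hx Hy Hc Hxu Hyw; simpl; rewrite Hs.
destruct (v x), (v y); unfold le; simpl; try congruence;
  destruct (v u), (v w); simpl; congruence.
Qed.

Lemma ax_monomial (m : mon) :
  ~ In M0 (mons s) -> (exists col, bip E col) ->
  axiomatizable (entails m).
Proof.
intros H0 [col Hcol]; destruct (classic (exists x y, E x y)) as [He|He].
2:{ apply ax_no_edge; intros [|x|x y] Hn; [contradiction|eauto|].
    exfalso; apply He; exists x, y; now left. }
assert (Hb : forall B, model B -> forall (v : nat -> B) r,
          (forall n, In n (mons s) -> mle v n r) <-> below L E v r).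
{ intros B HB v r; split.
  - intros H; split; [intros x Hx; now apply H in Hx|].
    intros x y [Hxy|Hxy]; apply H in Hxy; [exact Hxy|now apply (le_mulC HB)].
  - intros [H1 H2] [|x|x y] Hn; [contradiction|now apply H1|].
    apply H2; now left. }
destruct (has_kind_exists L E) as [k Hk].
destruct (fits_exists L E (edge_sym s) col k Hcol Hk) as [col' Hfit].
apply ax_iff with (horn L E m).
- intros B HB; split; intros H v r Hv; apply H, (Hb B HB); exact Hv.
- apply ax_horn with k col'; auto; [apply edge_sym|].
  intros B HB v r n x y Hv Lx Ly Hw Ho.
  (* The value of s itself lies below [r], so the identity xy ⪯ s of [R12] applies in the model. *)
  assert (Hs := proj2 (eval_le B HB v r s) (proj2 (Hb B HB v r) Hv)).
  apply (le_trans HB) with (2 := Hs).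
  exact (HB _ (letters_odd_walk x y n Lx Ly Hw Ho) v).
Qed.

Lemma ax_inequality (s1 : term) :
  axiomatizable (fun B => satisfies B (s1 ⪯ s)).
Proof.
destruct (classic (~ In M0 (mons s) /\ exists col, bip E col)) as [[H0 H]|H];
  [|now apply ax_degenerate].
apply ax_iff with (fun B => forall m, In m (mons s1) -> entails m B).
- intros B HB; apply (satisfies_le B HB).
- apply ax_forall_in; intros m _; now apply ax_monomial.
Qed.

End Inequality.

Theorem theorem6p1 :
  forall u v : term,
  exists E : list identity,
    (forall e, In e E ->
       In e F25 \/ exists n, 1 <= n /\ (e = id_gamma n \/ e = id_gamma_D n)) /\
    (forall B : algebra,
       subvariety (variety_gen R12) (Identity u v :: nil) B <->
       subvariety (variety_gen R12) E B).
Proof.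
intros u v.
destruct (ax_and _ _ (ax_inequality v u) (ax_inequality u v)) as (E & HE & H).
exists E; split; [exact HE|]; intros B; unfold subvariety.
split; intros [HV HS]; (split; [exact HV|]); assert (HB := model_variety_gen B HV).
- apply (H B HB), (satisfies_eq B HB), HS; now left.
- intros e [<-|[]]; apply (satisfies_eq B HB), (H B HB), HS.
Qed.
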